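(* Let $K$ be a field, let $n,d\ge 2$ be integers, and let $I\subset K[x_1,\ldots,x_n]$ be an equigenerated monomial ideal of height $n$ generated in degree $d$. Suppose that $I$ is not a proper pseudo-Frobenius power of another monomial ideal. Then $I$ is Freiman if and only if, up to a relabeling of the variables, $$I=(x_1,\ldots,x_r)^d+(x_{r+1}^d,\ldots,x_n^d)$$ for some positive integer $r$ with $r\le \min\{3,n\}$ if $d=2$, and $r\le\min\{2,n\}$ if $d\ge 3$.
   Context: $\mathfrak m=(x_1,\ldots,x_n)\subset S=K[x_1,\ldots,x_n]$. For a graded ideal $I\subset S$, $\mu(I)$ denotes the minimal number of generators of $I$; the fiber cone is $F(I)=\bigoplus_{k\ge 0} I^k/\mathfrak m I^k$, and the analytic spread $\ell(I)$ is the Krull dimension of $F(I)$. An ideal is equigenerated if all elements of a minimal set of generators have the same degree. An equigenerated monomial ideal $I$ is called Freiman if $\mu(I^2)=\ell(I)\mu(I)-\binom{\ell(I)}{2}$. For a monomial ideal $L$, $G(L)$ denotes its unique minimal set of monomial generators. If $G(L)=\{u_1,\ldots,u_m\}$ and $q\ge1$ is an integer, the $q$th pseudo-Frobenius power $L^{[q]}$ is the monomial ideal with $G(L^{[q]})=\{u_1^q,\ldots,u_m^q\}$; it is called a proper pseudo-Frobenius power of $L$ if $q\ge 2$. *)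

(* Defs.v *)
From HB Require Import structures.
From mathcomp Require Import all_boot all_order all_algebra all_fingroup.
From mathcomp Require Import generic_quotient ring_quotient.
From mathcomp Require Import boolp classical_sets mpoly.

Set Implicit Arguments.
Unset Strict Implicit.
Unset Printing Implicit Defensive.

Import GRing.Theory.
Local Open Scope classical_set_scope.
Local Open Scope ring_scope.

Section Ideals.
Variable R : comNzRingType.
Implicit Types (I J P : set R) (A : set R).

Definition is_ideal I : Prop :=
  [/\ I 0, forall x y, I x -> I y -> I (x + y) & forall a x, I x -> I (a * x)].

Definition is_prime_ideal P : Prop :=
  [/\ is_ideal P, ~ P 1 & forall x y, P (x * y) -> P x \/ P y].

Definition ideal_gen A : set R :=
  [set x | forall J, is_ideal J -> A `<=` J -> J x].

Definition ideal_add I J : set R := ideal_gen (I `|` J).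

Definition ideal_mul I J : set R := ideal_gen [set x * y | x in I & y in J].

Fixpoint ideal_exp I (k : nat) : set R :=
  if k is k'.+1 then ideal_mul I (ideal_exp I k') else setT.

Definition min_num_gens I (m : nat) : Prop :=
  (exists s : seq R, size s = m /\ I = ideal_gen [set` s]) /\
  (forall s : seq R, I = ideal_gen [set` s] -> (m <= size s)%N).

(* p 0 < p 1 < ... < p l; the values of p beyond l are irrelevant. *)
Definition prime_chain (l : nat) (p : nat -> set R) : Prop :=
  (forall i, (i <= l)%N -> is_prime_ideal (p i)) /\
  (forall i, (i < l)%N -> p i `<` p i.+1).

Definition krull_dim (h : nat) : Prop :=
  (exists p, prime_chain h p) /\ (forall l p, prime_chain l p -> (l <= h)%N).

Definition prime_height P (h : nat) : Prop :=
  (exists p, prime_chain h p /\ p h = P) /\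
  (forall l p, prime_chain l p -> p l = P -> (l <= h)%N).

Definition ideal_height I (h : nat) : Prop :=
  (exists P, [/\ is_prime_ideal P, I `<=` P & prime_height P h]) /\
  (forall P h', is_prime_ideal P -> I `<=` P -> prime_height P h' -> (h <= h')%N).

Lemma is_ideal_gen A : is_ideal (ideal_gen A).
Proof.
split=> [J [J0 _ _] _ //|x y Ix Iy J HJ AJ|a x Ix J HJ AJ].
  by case: (HJ) => _ JD _; apply: JD; [apply: Ix | apply: Iy].
by case: (HJ) => _ _ JM; apply: JM; apply: Ix.
Qed.

Lemma sub_ideal_gen A : A `<=` ideal_gen A.
Proof. by move=> x Ax J _; apply. Qed.

Lemma ideal_gen_min A J : is_ideal J -> A `<=` J -> ideal_gen A `<=` J.
Proof. by move=> HJ AJ x; apply. Qed.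

Lemma is_ideal_mul I J : is_ideal (ideal_mul I J).
Proof. exact: is_ideal_gen. Qed.

Lemma is_ideal_exp I k : is_ideal (ideal_exp I k).
Proof. by case: k => [|k]; [split | exact: is_ideal_gen]. Qed.

Lemma ideal_mul_in I J x y : I x -> J y -> ideal_mul I J (x * y).
Proof. by move=> Ix Jy; apply: sub_ideal_gen; exists x => //; exists y. Qed.

Lemma is_idealN I x : is_ideal I -> I x -> I (- x).
Proof. by case=> _ _ IM Ix; rewrite -mulN1r; apply: IM. Qed.

Lemma is_ideal_sum I (T : finType) (F : T -> R) :
  is_ideal I -> (forall i, I (F i)) -> I (\sum_i F i).
Proof. by case=> I0 ID _ HF; elim/big_ind: _. Qed.

Lemma ideal_expM I j k x y :
  ideal_exp I j x -> ideal_exp I k y -> ideal_exp I (j + k) (x * y).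
Proof.
move=> Ix Iy; elim: j x Ix => [|j IH] x /=.
  by case: (is_ideal_exp I k) => _ _ H _; apply: H.
move=> Hx; have H := is_ideal_exp I (j.+1 + k); case: (H) => H0 HD HM.
suff: [set x' | ideal_exp I (j.+1 + k) (x' * y)] x by [].
apply: Hx => [|_ [a Ia [b Ib <-]] /=].
  split=> /= [|u v Hu Hv|a u Hu]; first by rewrite mul0r.
  - by rewrite mulrDl; apply: HD.
  - by rewrite -mulrA; apply: HM.
by rewrite -mulrA; apply: ideal_mul_in => //; apply: IH.
Qed.

Lemma ideal_mul_expM M I j k x y : ideal_exp I j x ->
  ideal_mul M (ideal_exp I k) y -> ideal_mul M (ideal_exp I (j + k)) (x * y).
Proof.
move=> Ix Hy; have [H0 HD HM] := is_ideal_mul M (ideal_exp I (j + k)).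
suff: [set y' | ideal_mul M (ideal_exp I (j + k)) (x * y')] y by [].
apply: Hy => [|_ [a Ma [b Ib <-]] /=].
  split=> /= [|u v Hu Hv|a u Hu]; first by rewrite mulr0.
  - by rewrite mulrDr; apply: HD.
  - by rewrite mulrCA; apply: HM.
by rewrite mulrCA; apply: ideal_mul_in => //; apply: ideal_expM.
Qed.

End Ideals.

(* The Rees algebra, i.e. the direct sum of the I^k t^k inside R[t]. *)
Section Rees.
Variables (R : comNzRingType) (I : set R).

Definition rees_pred : {pred {poly R}} :=
  fun f => `[< forall k, ideal_exp I k f`_k >].

Lemma rees_predP (f : {poly R}) : reflect (forall k, ideal_exp I k f`_k) (f \in rees_pred).
Proof. exact: asboolP. Qed.

Lemma rees_subring : subring_closed rees_pred.
Proof.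
split=> [|f g /rees_predP Hf /rees_predP Hg|f g /rees_predP Hf /rees_predP Hg].
- apply/rees_predP => k; rewrite coef1.
  by case: k => [//|k]; case: (is_ideal_exp I k.+1).
- apply/rees_predP => k; rewrite coefB.
  have H := is_ideal_exp I k; case: (H) => _ HD _.
  by apply: HD => //; apply: is_idealN.
- apply/rees_predP => k; rewrite coefM.
  apply: is_ideal_sum => [|i]; first exact: is_ideal_exp.
  rewrite -[k in ideal_exp _ k](@subnKC i) -1?ltnS //.
  exact: ideal_expM.
Qed.

HB.instance Definition _ := GRing.isSubringClosed.Build {poly R} rees_pred
  rees_subring.

Record rees := Rees { rees_val :> {poly R}; _ : rees_val \in rees_pred }.

HB.instance Definition _ := [isSub for rees_val].
HB.instance Definition _ := [Choice of rees by <:].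
HB.instance Definition _ := [SubChoice_isSubComNzRing of rees by <:].

End Rees.

Section FiberCone.
Variables (K : fieldType) (n : nat).

Definition mpoly_max_ideal : set {mpoly K[n]} :=
  ideal_gen [set 'X_i | i in [set: 'I_n]].

Lemma mpoly_max_ideal_proper (J : set {mpoly K[n]}) :
  ~ ideal_mul mpoly_max_ideal J 1.
Proof.
move=> H; pose Z := [set p : {mpoly K[n]} | p@_0%MM = 0].
have HZ : is_ideal Z.
  split=> [|x y|a x]; rewrite /Z /=.
  - by rewrite mcoeff0.
  - by move=> x0 y0; rewrite mcoeffD x0 y0 addr0.
  - by move=> x0; rewrite rmorphM /= x0 mulr0.
have HmZ : mpoly_max_ideal `<=` Z.
  apply: ideal_gen_min => // _ [i _ <-]; rewrite /Z /= mcoeffX.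
  by case: eqP => // /(congr1 (@mdeg n)); rewrite mdeg1 mdeg0.
have /(_ HZ) : is_ideal Z -> Z 1.
  move=> _; apply: H => // _ [x /HmZ Zx [y _ <-]].
  by rewrite mulrC; case: HZ => _ _; apply.
by rewrite /Z /= mcoeff1 eqxx => /eqP; rewrite oner_eq0.
Qed.

Variable I : set {mpoly K[n]}.

Definition fiber_pred : {pred rees I} :=
  fun f => `[< forall k, ideal_mul mpoly_max_ideal (ideal_exp I k) (val f)`_k >].

Lemma fiber_predP (f : rees I) : reflect
  (forall k, ideal_mul mpoly_max_ideal (ideal_exp I k) (val f)`_k)
  (f \in fiber_pred).
Proof. exact: asboolP. Qed.

Lemma fiber_idealr : idealr_closed fiber_pred.
Proof.
split.
- apply/fiber_predP => k; rewrite raddf0 coef0.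
  by case: (is_ideal_mul mpoly_max_ideal (ideal_exp I k)).
- apply/negP => /fiber_predP/(_ 0%N); rewrite rmorph1 coef1 /=.
  exact: mpoly_max_ideal_proper.
move=> a u v /fiber_predP Hu /fiber_predP Hv; apply/fiber_predP => k.
have H := is_ideal_mul mpoly_max_ideal (ideal_exp I k); case: (H) => _ HD _.
rewrite rmorphD rmorphM coefD coefM; apply: HD => //.
apply: is_ideal_sum => // i.
rewrite -[k in ideal_exp _ k](@subnKC i) -1?ltnS //.
by apply: ideal_mul_expM => //; case: a => a /= /rees_predP.
Qed.

HB.instance Definition _ := isIdealr.Build (rees I) fiber_pred fiber_idealr.

(* The direct sum of the I^k / m I^k, realized as the quotient of the Rees
   algebra of I by its ideal of elements whose k-th component is in m I^k. *)
Definition fiber_cone : comNzRingType := {ideal_quot fiber_pred}.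

Definition analytic_spread (l : nat) : Prop := krull_dim fiber_cone l.

End FiberCone.

Section MonomialIdeals.
Variables (K : fieldType) (n : nat).
Implicit Types (I L : set {mpoly K[n]}) (G : set 'X_{1..n}).

Definition monomial_ideal_of G : set {mpoly K[n]} :=
  ideal_gen [set 'X_[u] | u in G].

Definition is_monomial_ideal I : Prop := exists G, I = monomial_ideal_of G.

(* "G = G(I)": an inclusion-minimal set of monomials (given by their exponents)
   generating I.  It is unique, and exists for every monomial ideal I. *)
Definition min_monomial_gens I G : Prop :=
  I = monomial_ideal_of G /\
  (forall G', G' `<=` G -> I = monomial_ideal_of G' -> G' = G).

Definition equigenerated_monomial I (d : nat) : Prop :=
  is_monomial_ideal I /\
  exists G, min_monomial_gens I G /\ forall u, G u -> mdeg u = d.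

Definition freiman I : Prop :=
  (exists d, equigenerated_monomial I d) /\
  exists m m2 l : nat,
    [/\ min_num_gens I m, min_num_gens (ideal_exp I 2) m2,
        analytic_spread I l & m2%:Z = l%:Z * m%:Z - 'C(l, 2)%:Z].

Definition pseudo_frobenius_power (q : nat) L I : Prop :=
  exists G, min_monomial_gens L G /\
            min_monomial_gens I [set (u *+ q)%MM | u in G].

Definition proper_pseudo_frobenius_power I : Prop :=
  exists (q : nat) L,
    [/\ (2 <= q)%N, is_monomial_ideal L & pseudo_frobenius_power q L I].

(* (x_1, ..., x_r)^d + (x_{r+1}^d, ..., x_n^d) after renaming each x_i to
   x_{s(i)}; indices are 0-based. *)
Definition freiman_model (d r : nat) (s : 'S_n) : set {mpoly K[n]} :=
  ideal_add
    (ideal_exp (ideal_gen [set 'X_(s i) | i in [set i : 'I_n | (i < r)%N]]) d)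
    (ideal_gen [set 'X_(s i) ^+ d | i in [set i : 'I_n | (r <= i)%N]]).

End MonomialIdeals.

(* Main.v *)
Require Import Defs.
From HB Require Import structures.
From mathcomp Require Import all_boot all_order all_algebra all_fingroup.
From mathcomp Require Import generic_quotient ring_quotient.
From mathcomp Require Import boolp classical_sets mpoly.
From mathcomp Require Import zify ring.

Set Implicit Arguments.
Unset Strict Implicit.
Unset Printing Implicit Defensive.

Import GRing.Theory.

(** Write [A] for the set of exponents of the minimal generators of [I], all of
    degree [d], and [e_i] for the unit vectors.

    The height forces [A] to contain all the pure powers [d e_i]: otherwise [I]
    lies in a prime generated by [n - 1] variables ([pure_power_in]).  The fiber
    cone of [I] is the subring of the polynomial ring generated by the monomials
    with exponents in [A], and has dimension [n]
    ([analytic_spread_pure_powers]).  Both facts rest on the bound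
    [prime_chain_leq] on prime chains in rings embedded in a polynomial ring in
    [n] variables over a field.  Minimal numbers of generators are cardinals of
    sets of exponents ([min_num_gens_homog]), so [I] is Freiman if and only if
    [A + A] has [n |A| - 'C(n, 2)] elements.

    Let [V] be the set of pure powers.  Two sums [d e_i + a] and [d e_j + b]
    with [i] different from [j] agree only if [a = d e_j] and [b = d e_i], so
    this number is exactly the cardinal of [V + A] ([size_pw_sums]), and [I] is
    Freiman if and only if [A + A = V + A] ([freiman_absorbing]).

    Modulo [d], the elements of [V] vanish, and the condition says that the
    classes of [A] form a subgroup of [(Z/d)^n], each class other than zero being
    represented by a single element of [A], with coordinates smaller than [d].
    The representatives of a class and of its opposite add up to [d] on
    their common support and both have degree [d], so that the support has two
    elements ([card_supp_mixed]).  If only one support occurs, the exponents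
    on it form a subgroup of [Z/d], which is everything unless [I] is a proper
    pseudo-Frobenius power ([single_edge]).  If several occur, all classes have
    order two ([two_torsion]), whence [d = 2] for the same reason, and
    supports are edges of a graph in which any two edges meet, and in which
    two sides of a triangle force the third: the graph is a triangle
    ([triangle_face]).  Conversely, in a face with two vertices, or with
    three if [d = 2], every sum of two elements has an exponent at least [d]
    ([powers_and_face_absorbing]). *)

(** * Prime chains and algebraic dependence *)

Section Box.
Local Open Scope classical_set_scope.
Local Open Scope ring_scope.

(** The exponents in a cube, as lists, so that polynomial relations can be
    handled by induction on the number of variables, removing the first one. *)
Fixpoint box (M l : nat) : seq (seq nat) :=
  if l is l'.+1 then [seq j :: s | j <- iota 0 M, s <- box M l'] else [:: [::]].

Lemma size_box M l : size (box M l) = (M ^ l)%N.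
Proof. by elim: l => //= l IH; rewrite size_allpairs size_iota IH expnS. Qed.

Lemma uniq_box M l : uniq (box M l).
Proof.
elim: l => //= l IH; apply: allpairs_uniq => //; first exact: iota_uniq.
by move=> [j s] [j' s'] _ _ /= [-> ->].
Qed.

Variable R : comNzRingType.

Fixpoint monom (b : nat -> R) (s : seq nat) : R :=
  if s is j :: s' then b 0%N ^+ j * monom (fun i => b i.+1) s' else 1.

Lemma sum_box_monomS M l (b : nat -> R) (c : seq nat -> R) :
  \sum_(s <- box M l.+1) c s * monom b s =
  \sum_(0 <= j < M) b 0%N ^+ j *
    \sum_(s <- box M l) c (j :: s) * monom (fun i => b i.+1) s.
Proof.
rewrite /= big_allpairs_dep /index_iota subn0; apply: eq_bigr => j _.
by rewrite mulr_sumr; apply: eq_bigr => s _; rewrite mulrCA.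
Qed.

(** A relation is read off at its lexicographically least exponent: climbing
    the chain, the powers of [b 0] can be cancelled modulo [p 0], and then
    every multiple of [b 0] vanishes modulo [p 1]. *)
Lemma prime_chain_independent M l (p : nat -> set R) (b : nat -> R)
    (c : seq nat -> R) :
  prime_chain l p ->
  (forall i, (i < l)%N -> p i.+1 (b i) /\ ~ p i (b i)) ->
  (forall s, p l (c s) -> c s = 0) ->
  p 0%N (\sum_(s <- box M l) c s * monom b s) ->
  {in box M l, forall s, c s = 0}.
Proof.
elim: l p b c => [|l IH] p b c [Hp Hsub] Hb Hc.
  rewrite /= big_seq1 mulr1 => Hp0 s; rewrite inE => /eqP ->; exact: Hc.
have [Ip0 N1 Pp0] := Hp 0%N isT; have [Ip1 _ _] := Hp 1%N isT.
have p01 : p 0%N `<=` p 1%N by case: (Hsub 0%N isT).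
have [pb1 pb0] := Hb 0%N isT.
rewrite sum_box_monomS; pose Q j := \sum_(s <- box M l) c (j :: s) * monom (fun i => b i.+1) s.
rewrite -[X in p _ X -> _]/(\sum_(0 <= j < M) b 0%N ^+ j * Q j) => HQ.
have pX j x : p 0%N (b 0%N ^+ j * x) -> p 0%N x.
  elim: j => [|j IHj]; first by rewrite mul1r.
  by rewrite exprS -mulrA => /Pp0 [].
have cj j : (j < M)%N -> {in box M l, forall s, c (j :: s) = 0}.
  elim/ltn_ind: j => j IHj jM.
  have Q0 i : (i < j)%N -> Q i = 0.
    move=> ij; rewrite /Q big_seq big1 // => s Hs.
    by rewrite (IHj i) ?mul0r // (ltn_trans ij).
  have [x Hx] : exists x, \sum_(0 <= i < M) b 0%N ^+ i * Q i
                     = b 0%N ^+ j * (Q j + b 0%N * x).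
    exists (\sum_(j.+1 <= i < M) b 0%N ^+ (i - j.+1) * Q i).
    rewrite (big_cat_nat (leq0n j) (ltnW jM)) //= big_nat big1 => [|i /andP[_ ij]]; last first.
      by rewrite Q0 // mulr0.
    rewrite add0r big_ltn // mulrDr; congr (_ + _).
    rewrite mulrA -exprSr mulr_sumr big_nat [RHS]big_nat.
    by apply: eq_bigr => i /andP[ji _]; rewrite mulrA -exprD subnKC.
  move: HQ; rewrite Hx => /pX/p01 H1.
  apply: (IH (fun i => p i.+1) (fun i => b i.+1) (fun s => c (j :: s))).
  - split=> i Hi; [exact: Hp | exact: Hsub].
  - by move=> i Hi; apply: Hb.
  - by move=> s; apply: Hc.
  case: Ip1 => _ D Mu.
  rewrite -[X in p _ X](addrK (b 0%N * x)); apply: D => //.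
  by rewrite -mulrN mulrC; apply: Mu.
by move=> s /allpairsP[[j t] [/= jM Ht ->]]; apply: cj; rewrite ?mem_iota // in jM *.
Qed.

End Box.

Section Dependence.
Local Open Scope classical_set_scope.
Local Open Scope ring_scope.
Variables (K : fieldType) (n : nat).
Implicit Types (p q : {mpoly K[n]}).

Definition deg_le (D : nat) p := forall m, p@_m != 0 -> (mdeg m <= D)%N.

Lemma deg_leW D E p : (D <= E)%N -> deg_le D p -> deg_le E p.
Proof. by move=> DE H m /H /leq_trans; apply. Qed.

Lemma deg_leM D E p q : deg_le D p -> deg_le E q -> deg_le (D + E) (p * q).
Proof.
move=> Hp Hq m; rewrite -mcoeff_msupp => /msuppM_le/allpairsP[[u v]] /=.
by rewrite !mcoeff_msupp => -[/Hp Hu /Hq Hv ->]; rewrite mdegD leq_add.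
Qed.

Lemma deg_leX D k p : deg_le D p -> deg_le (D * k) (p ^+ k).
Proof.
move=> Hp; elim: k => [|k IH]; last by rewrite exprS mulnS; apply: deg_leM.
move=> m; rewrite expr0 mcoeff1; case: (eqVneq m 0%MM) => [->|_]; by rewrite ?mdeg0 ?eqxx.
Qed.

Lemma deg_le_exists l (b : nat -> {mpoly K[n]}) :
  exists D, forall i, (i < l)%N -> deg_le D (b i).
Proof.
exists (\max_(i < l) msize (b i))%N => i il m; rewrite -mcoeff_msupp.
move=> /msize_mdeg_lt/ltnW/leq_trans; apply.
exact: (leq_bigmax (Ordinal il)).
Qed.

Lemma deg_le_monom M l D (b : nat -> {mpoly K[n]}) s :
  (forall i, (i < l)%N -> deg_le D (b i)) -> s \in box M l ->
  deg_le (D * (M * l)) (monom b s).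
Proof.
elim: l b s => [|l IH] b s Hb.
  rewrite inE => /eqP -> m /=; rewrite mcoeff1.
  case: (eqVneq m 0%MM) => [->|_]; by rewrite ?mdeg0 ?eqxx.
case/allpairsP=> -[j t] [/= jM Ht ->].
have {}jM : (j < M)%N by rewrite mem_iota in jM.
apply: (@deg_leW (D * M + D * (M * l))); first by rewrite mulnS mulnDr.
apply: deg_leM; last by apply: IH => // i il; apply: Hb.
by apply: (@deg_leW (D * j)); [rewrite leq_mul // ltnW | apply/deg_leX/Hb].
Qed.

(** The coefficients of the [s`_i] form a matrix with at most [N ^ n] relevant
    columns, one for each vector of exponents below [N], so its left kernel is
    nonzero. *)
Lemma linear_dependence N (s : seq {mpoly K[n]}) :
  (N ^ n < size s)%N -> {in s, forall p m, p@_m != 0 -> (mdeg m < N)%N} ->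
  exists2 v : 'rV[K]_(size s), v != 0 & \sum_i v 0 i *: s`_i = 0.
Proof.
move=> Hs Hdeg; pose T := {ffun 'I_n -> 'I_N}.
have cT : #|{: T}| = (N ^ n)%N by rewrite card_ffun !card_ord.
pose W : 'M[K]_(size s, #|{: T}|) :=
  \matrix_(i, j) (s`_i)@_[multinom val ((enum_val j : T) k) | k < n].
have /rowV0Pn[v /sub_kermxP HvW v0] : kermx W != 0.
  by rewrite -mxrank_eq0 mxrank_ker subn_eq0 -ltnNge (leq_ltn_trans (rank_leq_col W)) // cT.
exists v => //; apply/mpolyP => m; rewrite mcoeff0 raddf_sum /=.
have [mN|mN] := ltnP (mdeg m) N; last first.
  rewrite big1 // => k _; rewrite mcoeffZ.
  have [->|nz] := eqVneq (s`_k)@_m 0; first by rewrite mulr0.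
  by have := Hdeg _ (mem_nth 0 (ltn_ord k)) _ nz; rewrite ltnNge mN.
have mk k : (m k < N)%N.
  by apply: leq_ltn_trans mN; rewrite mdegE (bigD1 k) //= leq_addr.
pose f : T := [ffun k => Ordinal (mk k)].
have /matrixP/(_ 0 (enum_rank f)) := HvW; rewrite !mxE => Hsum.
rewrite -[RHS]Hsum; apply: eq_bigr => k _; rewrite mcoeffZ !mxE enum_rankK.
by congr (_ * _@_ _); apply/mnmP => j; rewrite mnmE ffunE.
Qed.

(** There are [M ^ l] products of powers below [M], in a space of polynomials
    whose dimension is at most a constant times [M ^ n]. *)
Lemma algebraic_dependence l (b : nat -> {mpoly K[n]}) : (n < l)%N ->
  exists M (c : seq nat -> K),
    \sum_(s <- box M l) c s *: monom b s = 0 /\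
    exists2 s, s \in box M l & c s != 0.
Proof.
move=> nl; have [D HD] := deg_le_exists l b.
(* The box of side M yields M ^ l products, of degree less than N, and
   N <= (D * l + 1) * M; the choice of M makes (D * l + 1) ^ n smaller than M. *)
pose M := ((D * l).+1 ^ n).+1; pose N := (D * (M * l)).+1.
have HN : (N ^ n < M ^ l)%N.
  apply: (@leq_ltn_trans (((D * l).+1 * M) ^ n)).
    have : (N <= (D * l).+1 * M)%N by rewrite /N mulnCA; lia.
    by case: (n) => // n' HN; rewrite leq_exp2r.
  apply: (@leq_trans (M ^ n.+1)); last by rewrite leq_pexp2l.
  by rewrite expnMn expnS ltn_pmul2r // expn_gt0.
pose bx := box M l; pose S := [seq monom b s | s <- bx].
have sS : size S = size bx by rewrite size_map.
have [||v v0 Hv] := @linear_dependence N S.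
- by rewrite sS size_box.
- by move=> p /mapP[s Hs ->] m Hm; rewrite ltnS; apply: (deg_le_monom HD Hs).
exists M, (fun s => if insub (index s bx) is Some i then v 0 i else 0); split.
  rewrite -[RHS]Hv (big_nth [::]) -/bx -sS big_mkord; apply: eq_bigr => i _.
  have ib : (i < size bx)%N by rewrite -sS.
  by rewrite index_uniq ?uniq_box // valK (nth_map [::]).
have /rV0Pn[i vi] := v0; have ib : (i < size bx)%N by rewrite -sS.
exists (nth [::] bx i); first exact: mem_nth.
by rewrite index_uniq ?uniq_box // valK.
Qed.

Lemma rmorph_monom (R S : comNzRingType) (f : {rmorphism R -> S}) b s :
  f (monom b s) = monom (f \o b) s.
Proof. by elim: s b => [|j s IH] b /=; rewrite ?rmorph1 // rmorphM rmorphXn IH. Qed.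

(** Any [n + 1] elements of [R] satisfy a polynomial relation over [K], so the
    elements separating the primes of a long chain would contradict
    [prime_chain_independent]. *)
Lemma prime_chain_leq (R : comNzRingType) (phi : {rmorphism R -> {mpoly K[n]}})
    (iota : K -> R) l (p : nat -> set R) :
  injective phi -> (forall c, phi (iota c) = c%:MP) ->
  prime_chain l p -> (l <= n)%N.
Proof.
move=> inj Hi Hp; rewrite leqNgt; apply/negP => nl; case: (Hp) => Pp Sp.
have /choice[b Hb] i : exists x, (i < l)%N -> p i.+1 x /\ ~ p i x.
  case: (boolP (i < l)%N) => [il|_]; last by exists 0.
  have [_] := Sp i il; rewrite -existsNP => -[x /existsNP[px npx]].
  by exists x.
have [M [c [c0 [s Hs cs]]]] := algebraic_dependence (phi \o b) nl.
pose c' s := iota (c s).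
have rel0 : \sum_(s <- box M l) c' s * monom b s = 0.
  apply: inj; rewrite raddf0 raddf_sum -[RHS]c0 /=; apply: eq_bigr => t _.
  by rewrite rmorphM /= Hi rmorph_monom mul_mpolyC.
have [[p0 _ pM] np1 _] := Pp l (leqnn l).
have Hc' t : p l (c' t) -> c' t = 0.
  rewrite /c'; have [->|ct] := eqVneq (c t) 0.
    by move=> _; apply: inj; rewrite Hi !raddf0.
  move=> pt; case: np1; have -> : 1 = iota (c t)^-1 * iota (c t).
    by apply: inj; rewrite rmorph1 rmorphM /= !Hi -mpolyCM mulVf.
  exact: pM.
have {p0} p0 : p 0%N 0 by case: (Pp 0%N isT) => -[].
have /(_ s Hs) : {in box M l, forall s, c' s = 0}.
  by apply: (prime_chain_independent Hp Hb Hc'); rewrite rel0.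
move=> /(congr1 phi); rewrite Hi raddf0 => /(congr1 (mcoeff 0%MM)).
by rewrite mcoeffC mcoeff0 eqxx mulr1 => /eqP; rewrite (negbTE cs).
Qed.

End Dependence.

(** * Monomial ideals *)

Section MonomialTheory.
Local Open Scope classical_set_scope.
Local Open Scope ring_scope.
Variables (K : fieldType) (n : nat).
Implicit Types (I : set {mpoly K[n]}) (G H : set 'X_{1..n}) (u v m : 'X_{1..n}).
Local Notation mono := (@monomial_ideal_of K n).

(** Multiplication only raises exponents, so the polynomials supported above [G]
    form an ideal. *)
Lemma monomial_idealP G (p : {mpoly K[n]}) :
  mono G p <-> (forall m, p@_m != 0 -> exists2 u, G u & (u <= m)%MM).
Proof.
split=> [Hp|Hp]; last first.
  have [I0 ID IM] := is_ideal_gen [set 'X_[K, u] | u in G].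
  rewrite [p]mpolyE big_seq; elim/big_ind: _ => // m; rewrite mcoeff_msupp.
  case/Hp=> u Gu um; rewrite -(submK um) mpolyXD scalerAl.
  by apply: IM; apply: sub_ideal_gen; exists u.
pose J := [set p : {mpoly K[n]} |
  forall m, p@_m != 0 -> exists2 u, G u & (u <= m)%MM].
suff : J p by [].
apply: Hp => [|_ [u Gu <-] m]; last first.
  rewrite mcoeffX; case: (eqVneq u m) => [<- _|]; last by rewrite eqxx.
  by exists u; rewrite ?lepm_refl.
split=> [m|x y Hx Hy m|a x Hx m]; first by rewrite mcoeff0 eqxx.
- rewrite mcoeffD; have [x0|/Hx//] := eqVneq x@_m 0.
  by rewrite x0 add0r => /Hy.
- rewrite -mcoeff_msupp => /msuppM_le/allpairsP[[a' u] /= [_]].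
  rewrite mcoeff_msupp => /Hx[w Gw wu] ->; exists w => //.
  by apply: lepm_trans wu _; apply: lem_addl.
Qed.

Lemma monomial_idealX G m : mono G 'X_[m] <-> exists2 u, G u & (u <= m)%MM.
Proof.
rewrite monomial_idealP; split=> [|[u Gu um] m']; first apply.
  by rewrite mcoeffX eqxx oner_eq0.
by rewrite mcoeffX; case: (eqVneq m m') => [<- _|]; [exists u | rewrite eqxx].
Qed.

Lemma mono_gen G u : G u -> mono G 'X_[u].
Proof. by move=> Gu; apply: sub_ideal_gen; exists u. Qed.

Lemma eq_ideal_gen (A B : set {mpoly K[n]}) :
  A `<=` ideal_gen B -> B `<=` ideal_gen A -> ideal_gen A = ideal_gen B.
Proof.
by move=> AB BA; apply/seteqP; split; apply: ideal_gen_min => //; exact: is_ideal_gen.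
Qed.

Lemma mono_mul G H :
  ideal_mul (mono G) (mono H) = mono [set (u + v)%MM | u in G & v in H].
Proof.
apply: eq_ideal_gen => [_ [x Gx [y Hy <-]]|_ [_ [u Gu [v Hv <-]] <-]]; last first.
  by rewrite mpolyXD; apply: ideal_mul_in; apply: mono_gen.
apply/monomial_idealP => m; rewrite -mcoeff_msupp => /msuppM_le.
case/allpairsP=> -[a b] /= []; rewrite !mcoeff_msupp => xa yb ->.
have [u Gu ua] := (monomial_idealP _ _).1 Gx _ xa.
have [v Hv vb] := (monomial_idealP _ _).1 Hy _ yb.
exists (u + v)%MM; first by exists u => //; exists v.
by apply/mnm_lepP => i; rewrite !mnmDE leq_add //; apply/mnm_lepP.
Qed.

Lemma mono0 : mono [set 0%MM] = setT.
Proof.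
apply/seteqP; split=> // p _; apply/monomial_idealP => m _.
by exists 0%MM => //; apply/mnm_lepP => i; rewrite mnm0E.
Qed.

Lemma mono_add G H : ideal_add (mono G) (mono H) = mono (G `|` H).
Proof.
apply: eq_ideal_gen => [p [/monomial_idealP Hp|/monomial_idealP Hp]|_ [u [Gu|Hu] <-]].
- by apply/monomial_idealP => m /Hp[u Gu um]; exists u => //; left.
- by apply/monomial_idealP => m /Hp[u Gu um]; exists u => //; right.
- by apply: sub_ideal_gen; left; apply: mono_gen.
- by apply: sub_ideal_gen; right; apply: mono_gen.
Qed.

Lemma mono_sqr G : ideal_exp (mono G) 2 = mono [set (u + v)%MM | u in G & v in G].
Proof.
rewrite /= -mono0 !mono_mul; congr mono; apply/seteqP; split=> m.
- by case=> u Gu [_ [v Gv [_ -> <-]] <-]; exists u => //; exists v; rewrite ?addm0.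
- case=> u Gu [v Gv <-]; exists u => //; exists v => //.
  by exists v => //; exists 0%MM; rewrite ?addm0.
Qed.

Lemma lepm_mdeg_eq u m : (u <= m)%MM -> mdeg u = mdeg m -> u = m.
Proof.
move=> um; rewrite -{1}(submK um) mdegD -[LHS]add0n => /eqP.
rewrite eqn_add2r eq_sym mdeg_eq0 => /eqP H0.
by rewrite -[RHS](submK um) H0 add0m.
Qed.

(** Between monomials of the same degree, divisibility is equality. *)
Lemma mono_homog_sub G H D : (forall u, G u -> mdeg u = D) ->
  (forall u, H u -> mdeg u = D) -> mono G `<=` mono H -> G `<=` H.
Proof.
move=> HG HH sGH u Gu; have /sGH/monomial_idealX[v Hv vu] := mono_gen Gu.
by rewrite -(lepm_mdeg_eq vu) // HH // HG.
Qed.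

Lemma mono_homog_inj G H D : (forall u, G u -> mdeg u = D) ->
  (forall u, H u -> mdeg u = D) -> mono G = mono H -> G = H.
Proof.
move=> HG HH E; apply/seteqP; split.
- by apply: (mono_homog_sub HG HH); rewrite E.
- by apply: (mono_homog_sub HH HG); rewrite E.
Qed.

Lemma min_gens_homog G D : (forall u, G u -> mdeg u = D) ->
  min_monomial_gens (mono G) G.
Proof.
move=> HG; split=> // G' G'G /esym E.
by apply: (mono_homog_inj (D := D)) E => u; [move/G'G; apply: HG | apply: HG].
Qed.

Lemma homog_gens_finite G D : (forall u, G u -> mdeg u = D) ->
  exists2 g : seq 'X_{1..n}, uniq g & G = [set` g].
Proof.
move=> HG; pose T := 'X_{1..n < D.+1}.
exists (map (@bmnm n D.+1) [seq m <- enum {: T} | `[< G (bmnm (m : T)) >]]).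
  by rewrite map_inj_uniq => [|x y]; [exact/filter_uniq/enum_uniq | apply: val_inj].
apply/seteqP; split=> u /=.
  move=> Gu; have uD : (mdeg u < D.+1)%N by rewrite HG.
  apply/mapP; exists (BMultinom uD) => //.
  by rewrite mem_filter mem_enum andbT; apply/asboolP.
by case/mapP=> m; rewrite mem_filter => /andP[/asboolP Gm _] ->.
Qed.

Lemma ideal_gen_seqP (s : seq {mpoly K[n]}) x : ideal_gen [set` s] x ->
  exists a : 'I_(size s) -> {mpoly K[n]}, x = \sum_i a i * s`_i.
Proof.
pose J := [set x | exists a : 'I_(size s) -> {mpoly K[n]}, x = \sum_i a i * s`_i].
apply: (@ideal_gen_min _ _ J) => [|y /= ys].
  split=> [|_ _ [a ->] [b ->]|c _ [a ->]].
  - by exists (fun _ => 0); rewrite big1 // => i _; rewrite mul0r.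
  - exists (fun i => a i + b i); rewrite -big_split.
    by apply: eq_bigr => i _; rewrite mulrDl.
  - exists (fun i => c * a i); rewrite mulr_sumr.
    by apply: eq_bigr => i _; rewrite mulrA.
have iy : (index y s < size s)%N by rewrite index_mem.
exists (fun i => (i == Ordinal iy)%:R); rewrite (bigD1 (Ordinal iy)) //= eqxx mul1r.
by rewrite nth_index // big1 ?addr0 // => i /negbTE ->; rewrite mul0r.
Qed.

Lemma min_num_gens_inj I k l : min_num_gens I k -> min_num_gens I l -> k = l.
Proof.
move=> [[s [ss Is]] kmin] [[t [st It]] lmin].
by apply/eqP; rewrite eqn_leq; apply/andP; split; [rewrite -st kmin | rewrite -ss lmin].
Qed.

Definition ord_ge (D : nat) (p : {mpoly K[n]}) :=
  forall m, p@_m != 0 -> (D <= mdeg m)%N.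

Lemma ord_geM D E p q : ord_ge D p -> ord_ge E q -> ord_ge (D + E) (p * q).
Proof.
move=> Hp Hq m; rewrite -mcoeff_msupp => /msuppM_le/allpairsP[[u v]] /=.
by rewrite !mcoeff_msupp => -[/Hp Hu /Hq Hv ->]; rewrite mdegD leq_add.
Qed.

Lemma mono_ord_ge G D p : (forall u, G u -> mdeg u = D) -> mono G p -> ord_ge D p.
Proof.
move=> HG /monomial_idealP Hp m /Hp[u /HG <- um].
by rewrite -(submK um) mdegD leq_addl.
Qed.

Lemma mcoeffM_low D (a p : {mpoly K[n]}) u : ord_ge D p -> mdeg u = D ->
  (a * p)@_u = a@_0%MM * p@_u.
Proof.
move=> Hp uD; rewrite -[in LHS](subrK (a@_0%MM)%:MP a) mulrDl mcoeffD mcoeffCM.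
rewrite [X in X + _](_ : _ = 0) ?add0r //; apply/eqP/negPn/negP => nz.
have H1 : ord_ge 1 (a - (a@_0%MM)%:MP).
  move=> m; rewrite lt0n mdeg_eq0; apply: contraNneq => ->.
  by rewrite mcoeffB mcoeffC eqxx mulr1 subrr.
by have := ord_geM H1 Hp nz; rewrite uD add1n ltnn.
Qed.

(** Every element of the ideal has order at least [D], so in degree [D] only
    the constant terms of the coefficients count: the degree-[D] parts of any
    generators span a space of dimension [size g]. *)
Lemma min_num_gens_homog (g : seq 'X_{1..n}) D : uniq g ->
  {in g, forall u, mdeg u = D} -> min_num_gens (mono [set` g]) (size g).
Proof.
move=> ug Hg; split.
  exists [seq 'X_[u] | u <- g]; rewrite size_map; split=> //; congr ideal_gen.
  apply/seteqP; split=> [_ [u gu <-]|_ /mapP[u gu ->]]; last by exists u.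
  by apply/mapP; exists u.
move=> s Is.
have sI i : mono [set` g] s`_i.
  have [ile|igt] := ltnP i (size s); last first.
    by rewrite nth_default //; case: (is_ideal_gen [set 'X_[K, u] | u in [set` g]]).
  by rewrite Is; apply: sub_ideal_gen; apply: mem_nth.
have gD (i : 'I_(size g)) : mdeg (nth 0%MM g i) = D by apply: Hg; apply: mem_nth.
have /choice[a Ha] (i : 'I_(size g)) : exists a : 'I_(size s) -> {mpoly K[n]},
    'X_[nth 0%MM g i] = \sum_j a j * s`_j.
  by apply: ideal_gen_seqP; rewrite -Is; apply: mono_gen; apply: mem_nth.
pose B : 'M[K]_(size g, size s) := \matrix_(i, j) (a i j)@_0%MM.
pose C : 'M[K]_(size s, size g) := \matrix_(j, k) (s`_j)@_(nth 0%MM g k).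
have BC : B *m C = 1%:M.
  apply/matrixP => i k; rewrite !mxE.
  have := congr1 (mcoeff (nth 0%MM g k)) (Ha i); rewrite mcoeffX nth_uniq // => ->.
  rewrite raddf_sum; apply: eq_bigr => j _ /=; rewrite !mxE.
  by rewrite (mcoeffM_low _ (mono_ord_ge Hg (sI j)) (gD k)).
by rewrite -(mxrank1 K (size g)) -BC (leq_trans (mxrankM_maxr _ _)) ?rank_leq_row.
Qed.

End MonomialTheory.

(** * Coordinate primes and the height *)

Section CoordinatePrimes.
Local Open Scope classical_set_scope.
Local Open Scope ring_scope.
Variables (K : fieldType) (n : nat).
Implicit Types (S T : {pred 'I_n}) (p q : {mpoly K[n]}) (m : 'X_{1..n}).
Local Notation mono := (@monomial_ideal_of K n).

Definition coord_prime S : set {mpoly K[n]} := mono [set U_(i)%MM | i in [set` S]].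

Lemma coord_primeP S p :
  coord_prime S p <-> (forall m, p@_m != 0 -> exists2 i, i \in S & m i != 0%N).
Proof.
rewrite /coord_prime monomial_idealP; split=> H m /H.
  by case=> _ [i iS <-]; rewrite lep1mP; exists i.
by case=> i iS mi; exists U_(i)%MM; [exists i | rewrite lep1mP].
Qed.

Lemma coord_primeX S m : coord_prime S 'X_[m] <-> exists2 i, i \in S & m i != 0%N.
Proof.
rewrite coord_primeP; split=> [|H m']; first by apply; rewrite mcoeffX eqxx oner_eq0.
by rewrite mcoeffX; case: (eqVneq m m') => [<- _|]; rewrite ?eqxx.
Qed.

Lemma coord_primeS S T : {subset S <= T} -> coord_prime S `<=` coord_prime T.
Proof.
move=> ST p /coord_primeP Hp; apply/coord_primeP => m /Hp[i iS mi].
by exists i => //; apply: ST.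
Qed.

(** The substitution whose kernel is [coord_prime S], which is prime because the
    target is a domain. *)
Definition kill_vars S p : {mpoly K[n]} :=
  p \mPo [tuple if i \in S then 0 else 'X_i | i < n].

Lemma kill_varsX S m :
  kill_vars S 'X_[m] = if [exists i in S, m i != 0%N] then 0 else 'X_[m].
Proof.
rewrite /kill_vars comp_mpolyX; case: existsP => [[i /andP[iS mi]]|H].
  by rewrite (bigD1 i) //= tnth_mktuple iS expr0n (negbTE mi) mul0r.
rewrite [RHS]mpolyXE_id; apply: eq_bigr => i _; rewrite tnth_mktuple.
case: ifP => // iS; have [->|mi] := eqVneq (m i) 0%N; first by rewrite !expr0.
by case: H; exists i; rewrite iS.
Qed.

Lemma kill_vars_eq0 S p : kill_vars S p = 0 <-> coord_prime S p.
Proof.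
have E : kill_vars S p = \sum_(m <- msupp p) p@_m *: kill_vars S 'X_[m].
  rewrite /kill_vars [in LHS](mpolyE p) raddf_sum /=.
  by apply: eq_bigr => m _; rewrite comp_mpolyZ.
rewrite coord_primeP; split=> [H0 m pm|H]; last first.
  rewrite E big_seq big1 // => m; rewrite mcoeff_msupp => /H[i iS mi].
  by rewrite kill_varsX ifT ?scaler0 //; apply/existsP; exists i; rewrite iS.
have [/existsP[i /andP[iS mi]]|/negbTE nS] := boolP [exists i in S, m i != 0%N].
  by exists i.
have := congr1 (mcoeff m) H0; rewrite E raddf_sum mcoeff0 /=.
rewrite (bigD1_seq m) ?msupp_uniq ?mcoeff_msupp //= big1 ?addr0 => [|m' m'm].
  by rewrite kill_varsX nS mcoeffZ mcoeffX eqxx mulr1 => /eqP; rewrite (negbTE pm).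
rewrite kill_varsX; case: ifP => _; rewrite mcoeffZ ?mcoeff0 ?mulr0 //.
by rewrite mcoeffX (negbTE m'm) mulr0.
Qed.

Lemma coord_prime_prime S : is_prime_ideal (coord_prime S).
Proof.
split; first exact: is_ideal_gen.
- move/coord_primeP/(_ 0%MM); rewrite mcoeff1 eqxx oner_eq0 => -[] // i _.
  by rewrite mnm0E.
- move=> x y; rewrite -!kill_vars_eq0 /kill_vars rmorphM => /eqP.
  by rewrite mulf_eq0 => /orP[] /eqP; [left | right].
Qed.

Lemma krull_dim_mpoly_leq l (p : nat -> set {mpoly K[n]}) :
  prime_chain l p -> (l <= n)%N.
Proof. exact: (@prime_chain_leq _ _ _ idfun (@mpolyC n K)). Qed.

(** The zero locus of [coord_prime (predC1 i)] is a line, so its height is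
    less than [n]: any chain below it extends to the maximal ideal. *)
Lemma height_coord_line i :
  exists2 h, (h < n)%N & prime_height (coord_prime (predC1 i)) h.
Proof.
set P := coord_prime _.
pose ends l := exists2 p, @prime_chain {mpoly K[n]} l p & p l = P.
have lt_n l : ends l -> (l < n)%N.
  case=> p [Hp Sp] pl; pose p' k := if (k <= l)%N then p k else coord_prime predT.
  apply: (@krull_dim_mpoly_leq l.+1 p'); split=> k kl; rewrite /p'.
    by case: ifP => // kl'; [apply: Hp | apply: coord_prime_prime].
  rewrite (_ : (k <= l)%N) //; have [kl'|lk] := ltnP k l; first exact: Sp.
  have -> : k = l by apply/eqP; rewrite eqn_leq lk andbT.
  rewrite pl; split; first exact: coord_primeS.
  move=> H; have /H/coord_primeX[j] : coord_prime predT 'X_i.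
    by apply/coord_primeX; exists i; rewrite // mnm1E eqxx.
  by rewrite inE mnm1E eq_sym; case: eqP.
have ex0 : exists l, `[< ends l >].
  exists 0%N; apply/asboolP; exists (fun _ => P) => //; split=> // *.
  exact: coord_prime_prime.
have bnd l : `[< ends l >] -> (l <= n)%N by move=> /asboolP/lt_n/ltnW.
case: (ex_maxnP ex0 bnd) => h /asboolP Hh hmax; exists h; first exact: lt_n.
split; first by case: Hh => p; exists p.
by move=> l p Hp pl; apply: hmax; apply/asboolP; exists p.
Qed.

(** If [X_i ^ d] is missing, every generator involves a variable other than
    [X_i], so the ideal lies in the prime of the [i]-th coordinate line. *)
Lemma pure_power_in (G : set 'X_{1..n}) d : (forall u, G u -> mdeg u = d) ->
  ideal_height (mono G) n -> forall i, G (U_(i) *+ d)%MM.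
Proof.
move=> HG [_ Hmin] i; apply: contrapT => Gi.
have [h hn Hh] := height_coord_line i.
have := Hmin _ h (coord_prime_prime _) _ Hh; rewrite leqNgt hn => /(_ _)/negP[] //.
apply: ideal_gen_min => [|_ [u Gu <-]]; first exact: is_ideal_gen.
apply/coord_primeX; apply: contrapT => H; apply: Gi.
suff <- : u = (U_(i) *+ d)%MM by [].
have u0 j : j != i -> u j = 0%N.
  by move=> ji; apply/eqP/negPn/negP => uj; apply: H; exists j.
apply/mnmP => j; rewrite mulmnE mnm1E.
case: eqVneq => [<-|ij]; last by rewrite mul0n u0 // eq_sym.
rewrite mul1n -(HG u Gu) mdegE (bigD1 i) //= big1 ?addn0 //.
Qed.

End CoordinatePrimes.

(** * The fiber cone as a toric ring *)

Section FiberConeEmbedding.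
Local Open Scope classical_set_scope.
Local Open Scope ring_scope.
Variables (K : fieldType) (n : nat).
Implicit Types (p q : {mpoly K[n]}) (m : 'X_{1..n}).
Local Notation mono := (@monomial_ideal_of K n).
Local Notation pi_deg := (pihomog [measure of mdeg]).

Lemma mcoeff_pihomog e p m : (pi_deg e p)@_m = if mdeg m == e then p@_m else 0.
Proof.
rewrite pihomogE raddf_sum -big_filter /=.
have us : uniq [seq i <- msupp p | mdeg i == e] by rewrite filter_uniq ?msupp_uniq.
have out m' : m' != m -> mcoeff m (p@_m' *: 'X_[m']) = 0.
  by move=> ne; rewrite mcoeffZ mcoeffX (negbTE ne) mulr0.
have [Hm|] := boolP (m \in [seq i <- msupp p | mdeg i == e]).
  rewrite (bigD1_seq m) //= big1 => [|m' /out //].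
  rewrite addr0 mcoeffZ mcoeffX eqxx mulr1.
  by move: Hm; rewrite mem_filter => /andP[-> _].
move=> Hm; rewrite big_seq big1 => [|m' Hm']; last first.
  by apply: out; apply: contraNneq Hm => <-.
move: Hm; rewrite mem_filter mcoeff_msupp.
by case: ifP => //= _; rewrite negbK => /eqP.
Qed.

Lemma pihomog_ord_gt D p : ord_ge D.+1 p -> pi_deg D p = 0.
Proof.
move=> Hp; apply/mpolyP => m; rewrite mcoeff_pihomog mcoeff0.
case: eqP => // mD; apply/eqP/negPn/negP => /Hp; by rewrite mD ltnn.
Qed.

Lemma ord_ge_sub_pihomog D p : ord_ge D p -> ord_ge D.+1 (p - pi_deg D p).
Proof.
move=> Hp m; rewrite mcoeffB mcoeff_pihomog.
case: (eqVneq (mdeg m) D) => [_|mD]; rewrite ?subrr ?eqxx // subr0 => /Hp.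
by rewrite leq_eqVlt eq_sym (negbTE mD).
Qed.

Lemma ord_ge_pihomog D p : ord_ge D (pi_deg D p).
Proof.
by move=> m; rewrite mcoeff_pihomog; case: (eqVneq (mdeg m) D) => [->|]; rewrite ?eqxx.
Qed.

(** The forms of lowest degree are multiplicative. *)
Lemma pihomogM D E p q : ord_ge D p -> ord_ge E q ->
  pi_deg (D + E) (p * q) = pi_deg D p * pi_deg E q.
Proof.
move=> Hp Hq; set p0 := pi_deg D p; set q0 := pi_deg E q.
have -> : p * q = p0 * q0 + (p0 * (q - q0) + (p - p0) * q) by ring.
rewrite pihomogD [X in _ + X]pihomog_ord_gt ?addr0.
  by rewrite pihomog_dE // dhomogM // pihomogP.
move=> m; rewrite mcoeffD => nz.
have [z|nz0] := eqVneq (p0 * (q - q0))@_m 0.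
  rewrite z add0r in nz; rewrite -addSn.
  exact: (ord_geM (ord_ge_sub_pihomog Hp) Hq nz).
rewrite -addnS.
exact: (ord_geM (@ord_ge_pihomog D p) (ord_ge_sub_pihomog Hq) nz0).
Qed.

Variables (G : set 'X_{1..n}) (d : nat).
Hypotheses (d_gt0 : (0 < d)%N) (HG : forall u, G u -> mdeg u = d).
Local Notation I := (mono G).

Fixpoint sumset_exp (k : nat) : set 'X_{1..n} :=
  if k is k'.+1 then [set (u + v)%MM | u in G & v in sumset_exp k'] else [set 0%MM].

Lemma mono_exp k : ideal_exp I k = mono (sumset_exp k).
Proof. by elim: k => [|k /= ->]; rewrite /= ?mono0 ?mono_mul. Qed.

Lemma mdeg_sumset_exp k u : sumset_exp k u -> mdeg u = (d * k)%N.
Proof.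
elim: k u => [_ ->|k IH _ [u Gu [v /IH Hv <-]]]; first by rewrite mdeg0 muln0.
by rewrite mdegD Hv (HG Gu) mulnS.
Qed.

Lemma ord_ge_exp k p : ideal_exp I k p -> ord_ge (d * k) p.
Proof. by rewrite mono_exp; apply: mono_ord_ge => u; apply: mdeg_sumset_exp. Qed.

(** [I ^ k] is generated in degree [d * k], so [m I ^ k] consists of its elements
    of larger order. *)
Lemma max_ideal_mul_expP k p : ideal_exp I k p ->
  ideal_mul (@mpoly_max_ideal K n) (ideal_exp I k) p <-> pi_deg (d * k) p = 0.
Proof.
have -> : @mpoly_max_ideal K n = mono [set U_(i)%MM | i in [set: 'I_n]].
  congr ideal_gen; apply/seteqP; split=> [_ [i _ <-]|_ [_ [i _ <-] <-]].
    by exists U_(i)%MM => //; exists i.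
  by exists i.
rewrite mono_exp mono_mul => Hp; split=> [Hmp|H0].
  apply: pihomog_ord_gt; apply: mono_ord_ge Hmp => _ [_ [i _ <-] [v /mdeg_sumset_exp Hv <-]].
  by rewrite mdegD mdeg1 Hv.
apply/monomial_idealP => m pm; have [u Gu um] := (monomial_idealP _ _).1 Hp m pm.
have /mnmP/eqfunP : (m - u)%MM <> 0%MM.
  move=> mu; have := congr1 (mcoeff m) H0; rewrite mcoeff_pihomog mcoeff0.
  rewrite -{1}(submK um) mu add0m (mdeg_sumset_exp Gu) eqxx => /eqP.
  by rewrite (negbTE pm).
rewrite negb_forall => /existsP[i]; rewrite mnm0E => mi.
exists (U_(i) + u)%MM; first by exists U_(i)%MM; [exists i | exists u].
apply/mnm_lepP => j; rewrite -[in leqRHS](submK um) !mnmDE leq_add2r.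
by move: j; apply/mnm_lepP; rewrite lep1mP.
Qed.

Definition initial_poly (f : rees I) : {poly {mpoly K[n]}} :=
  \poly_(k < size (val f)) pi_deg (d * k) (val f)`_k.

Lemma coef_initial_poly f k : (initial_poly f)`_k = pi_deg (d * k) (val f)`_k.
Proof. by rewrite coef_poly; case: ltnP => // fk; rewrite nth_default // raddf0. Qed.

Lemma rees_coef (f : rees I) k : ideal_exp I k (val f)`_k.
Proof. by case: f => f /= /rees_predP. Qed.

(** Evaluation at [1] forgets the grading of the Rees algebra without loss: the
    component of index [k] is found again in degree [d * k]. *)
Definition to_mpoly (f : rees I) : {mpoly K[n]} := (initial_poly f).[1].

Lemma initial_polyB f g : initial_poly (f - g) = initial_poly f - initial_poly g.
Proof.
apply/polyP => k; rewrite coefB !coef_initial_poly.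
by rewrite rmorphB coefB raddfB.
Qed.

Lemma initial_polyM f g : initial_poly (f * g) = initial_poly f * initial_poly g.
Proof.
apply/polyP => k; rewrite coefM !coef_initial_poly rmorphM coefM raddf_sum.
apply: eq_bigr => i _ /=; rewrite !coef_initial_poly.
rewrite -{1}(@subnKC i k) -1?ltnS // mulnDr pihomogM //; exact/ord_ge_exp/rees_coef.
Qed.

Lemma initial_poly1 : initial_poly 1 = 1.
Proof.
apply/polyP => k; rewrite coef_initial_poly rmorph1 coef1 /=.
case: eqP => [->|_]; last by rewrite raddf0.
by rewrite muln0 pihomog_dE // dhomog1.
Qed.

Lemma to_mpoly_is_zmod_morphism : zmod_morphism to_mpoly.
Proof. by move=> f g; rewrite /to_mpoly initial_polyB hornerD hornerN. Qed.

Lemma to_mpoly_is_monoid_morphism : monoid_morphism to_mpoly.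
Proof.
split; first by rewrite /to_mpoly initial_poly1 hornerC.
by move=> f g; rewrite /to_mpoly initial_polyM hornerM.
Qed.

HB.instance Definition _ := GRing.isZmodMorphism.Build (rees I) {mpoly K[n]}
  to_mpoly to_mpoly_is_zmod_morphism.
HB.instance Definition _ := GRing.isMonoidMorphism.Build (rees I) {mpoly K[n]}
  to_mpoly to_mpoly_is_monoid_morphism.

Lemma to_mpoly_eq0 f : (to_mpoly f == 0) = (f \in @fiber_pred K n I).
Proof.
rewrite /to_mpoly; apply/eqP/fiber_predP => [H k|H]; last first.
  suff -> : initial_poly f = 0 by rewrite horner0.
  apply/polyP => k; rewrite coef_initial_poly coef0.
  by apply/max_ideal_mul_expP; [apply: rees_coef | apply: H].
apply/max_ideal_mul_expP; first exact: rees_coef.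
apply/mpolyP => m; rewrite mcoeff_pihomog mcoeff0; case: eqP => // mk.
have := congr1 (mcoeff m) H; rewrite mcoeff0 horner_coef raddf_sum /=.
have E i : ((initial_poly f)`_i * 1 ^+ i)@_m = if i == k then (val f)`_k@_m else 0.
  rewrite expr1n mulr1 coef_initial_poly mcoeff_pihomog mk eqn_pmul2l // eq_sym.
  by case: eqP => [->|].
under eq_bigr do rewrite E.
rewrite -big_mkcond /=; have [ki|ki] := ltnP k (size (initial_poly f)).
  by rewrite (big_pred1 (Ordinal ki)).
move=> _; have := nth_default 0 ki; rewrite coef_initial_poly => /(congr1 (mcoeff m)).
by rewrite mcoeff_pihomog mk eqxx mcoeff0.
Qed.

Local Notation fc := (fiber_cone I).
Local Open Scope quotient_scope.

(** The kernel of [to_mpoly] is the ideal defining the fiber cone, so any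
    representative may be used. *)
Definition fc_mpoly (x : fc) : {mpoly K[n]} := to_mpoly (repr x).

Lemma fc_mpoly_pi f : fc_mpoly (\pi_fc f) = to_mpoly f.
Proof.
apply/eqP; rewrite -subr_eq0 -raddfB to_mpoly_eq0.
by rewrite Quotient.idealrBE reprK.
Qed.

Lemma fc_mpoly_is_zmod_morphism : zmod_morphism fc_mpoly.
Proof.
by elim/quotW => f; elim/quotW => g; rewrite -raddfB !fc_mpoly_pi raddfB.
Qed.

Lemma fc_mpoly_is_monoid_morphism : monoid_morphism fc_mpoly.
Proof.
split.
  apply: etrans (etrans (fc_mpoly_pi 1) (rmorph1 _)).
  by congr fc_mpoly; apply: esym (rmorph1 \pi_fc).
elim/quotW => f; elim/quotW => g; rewrite !fc_mpoly_pi -rmorphM.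
exact: etrans (fc_mpoly_pi (f * g)) (rmorphM _ f g).
Qed.

HB.instance Definition _ := GRing.isZmodMorphism.Build fc {mpoly K[n]}
  fc_mpoly fc_mpoly_is_zmod_morphism.
HB.instance Definition _ := GRing.isMonoidMorphism.Build fc {mpoly K[n]}
  fc_mpoly fc_mpoly_is_monoid_morphism.

Lemma fc_mpoly_inj : injective fc_mpoly.
Proof.
apply: raddf_inj => /= x; elim/quotW: x => f; rewrite fc_mpoly_pi => /eqP.
by rewrite to_mpoly_eq0 -[f]subr0 Quotient.idealrBE subr0 raddf0 => /eqP.
Qed.

Lemma rees_monomial_subproof k p :
  ideal_exp I k p -> p *: 'X^k \in rees_pred I.
Proof.
move=> Hp; apply/rees_predP => j; rewrite coefZ coefXn.
have [->|_] := eqVneq j k; first by rewrite mulr1.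
by rewrite mulr0; case: (is_ideal_exp I j).
Qed.

(** Such a form is the image of the element [p t ^ k] of the Rees algebra. *)
Lemma fc_mpoly_surj k p : ideal_exp I k p -> p \is (d * k).-homog ->
  exists x, fc_mpoly x = p.
Proof.
move=> Hp hp; exists (\pi_fc (Rees (rees_monomial_subproof Hp))).
rewrite fc_mpoly_pi /to_mpoly.
suff -> : initial_poly (Rees (rees_monomial_subproof Hp)) = p *: 'X^k.
  by rewrite hornerZ hornerXn expr1n mulr1.
apply/polyP => j; rewrite coef_initial_poly /= !coefZ !coefXn.
case: eqP => [->|_]; last by rewrite !mulr0 raddf0.
by rewrite !mulr1 pihomog_dE.
Qed.

Lemma preimage_prime (R S : comNzRingType) (f : {rmorphism R -> S}) P :
  is_prime_ideal P -> is_prime_ideal [set x | P (f x)].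
Proof.
case=> -[P0 PD PM] P1 Pp; split; first split=> /=.
- by rewrite raddf0.
- by move=> x y Px Py; rewrite raddfD; apply: PD.
- by move=> a x Px; rewrite rmorphM; apply: PM.
- by rewrite /= rmorph1.
- by move=> x y /=; rewrite rmorphM; apply: Pp.
Qed.

(** The fiber cone embeds into the polynomial ring, which bounds its dimension;
    pulling back the flag of coordinate primes attains the bound, as the
    powers [X_i ^ d] lie in the image. *)
Lemma analytic_spread_pure_powers : (forall i, G (U_(i) *+ d)%MM) ->
  forall l, analytic_spread I l <-> l = n.
Proof.
move=> HV l.
have ub k (p : nat -> set fc) : prime_chain k p -> (k <= n)%N.
  have /choice[iota Hiota] c : exists x, fc_mpoly x = c%:MP.
    apply: (@fc_mpoly_surj 0%N) => //; rewrite muln0 -[c%:MP]mulr1 mul_mpolyC.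
    by apply: dhomogZ; apply: dhomog1.
  exact: (@prime_chain_leq _ _ fc fc_mpoly iota k p fc_mpoly_inj Hiota).
have lb : exists p : nat -> set fc, prime_chain n p.
  pose S k : {pred 'I_n} := [pred i : 'I_n | (i < k)%N].
  exists (fun k => [set x | coord_prime (K := K) (S k) (fc_mpoly x)]).
  split=> k kn; first by apply: preimage_prime; apply: coord_prime_prime.
  split=> [x|H].
    by apply: coord_primeS => i; rewrite !inE => /ltnW.
  have [x Hx] : exists x, fc_mpoly x = 'X_[U_(Ordinal kn) *+ d].
    apply: (@fc_mpoly_surj 1%N); last by rewrite dhomogX /= mdegMn mdeg1 mul1n muln1.
    by rewrite -[X in ideal_exp _ _ X]mulr1; apply: ideal_mul_in => //; apply: mono_gen.
  have /H : coord_prime (K := K) (S k.+1) (fc_mpoly x).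
    rewrite Hx; apply/coord_primeX; exists (Ordinal kn); rewrite ?inE //=.
    by rewrite mulmnE mnm1E eqxx mul1n -lt0n.
  rewrite /= Hx => /coord_primeX[j]; rewrite inE mulmnE mnm1E => jk.
  by case: (eqVneq (Ordinal kn) j) => [E|]; rewrite ?mul0n //; move: jk; rewrite -E ltnn.
split=> [[[p Hp] H]|->]; last by split.
by apply/eqP; rewrite eqn_leq (ub _ p Hp); case: lb => q /H.
Qed.

End FiberConeEmbedding.

(** * Counting: Freiman means that the pure powers form a reduction *)

Section PurePowers.
Local Open Scope classical_set_scope.
Local Open Scope ring_scope.
Variables (n d : nat).
Hypothesis d_gt0 : (0 < d)%N.
Implicit Types (i j k : 'I_n) (u v a b c e : 'X_{1..n}) (G : set 'X_{1..n}).
Local Notation pw i := (U_(i) *+ d)%MM.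

Lemma pwE i j : pw i j = ((i == j) * d)%N.
Proof. by rewrite mulmnE mnm1E. Qed.

Lemma mdeg_pw i : mdeg (pw i) = d.
Proof. by rewrite mdegMn mdeg1 mul1n. Qed.

Lemma pw_inj : injective (fun i : 'I_n => pw i).
Proof.
move=> i j /mnmP/(_ i); rewrite !pwE eqxx mul1n.
by case: eqP => // _ /eqP; rewrite mul0n (gtn_eqF d_gt0).
Qed.

Lemma eq_pw u i : mdeg u = d -> (d <= u i)%N -> u = pw i.
Proof.
move=> ud du; apply/esym/lepm_mdeg_eq; rewrite ?mdeg_pw //.
apply/mnm_lepP => j; rewrite pwE.
by case: eqVneq => [<-|_]; rewrite ?mul1n.
Qed.

Lemma pwD_inj i j a b : mdeg a = d -> mdeg b = d -> i != j ->
  (pw i + a)%MM = (pw j + b)%MM -> a = pw j /\ b = pw i.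
Proof.
move=> ad bd ij E; split; apply: eq_pw => //.
  have := congr1 (fun m : 'X_{1..n} => m j) E.
  by rewrite !mnmDE !pwE eqxx (negbTE ij) mul0n mul1n add0n => ->; apply: leq_addr.
have := congr1 (fun m : 'X_{1..n} => m i) E.
by rewrite !mnmDE !pwE eqxx eq_sym (negbTE ij) mul0n mul1n add0n => <-; apply: leq_addr.
Qed.

(** With [J] the ideal of the pure powers, this is [I ^ 2 = J I] for the
    monomial ideal [I] generated by [G]. *)
Definition absorbing G := forall a b, G a -> G b ->
  exists i c, G c /\ (a + b)%MM = (pw i + c)%MM.

Variable g : seq 'X_{1..n}.
Hypotheses (ug : uniq g) (Hg : {in g, forall u, mdeg u = d})
  (Vg : forall i, pw i \in g).

(** The only coincidences among the sums [pw i + a] exchange [(i, pw j)] with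
    [(j, pw i)]; only the pairs [(i, pw j)] with [i <= j] are retained. *)
Definition fresh (p : 'I_n * 'X_{1..n}) := [forall j : 'I_n, (j < p.1)%N ==> (p.2 != pw j)].

Definition pw_sums : seq 'X_{1..n} :=
  [seq (pw p.1 + p.2)%MM | p <- [seq (i, a) | i <- enum 'I_n, a <- g] & fresh p].

Lemma mem_pw_sums u :
  reflect (exists i c, c \in g /\ u = (pw i + c)%MM) (u \in pw_sums).
Proof.
apply: (iffP mapP) => [[[i a]]|[i [a [ag ->]]]].
  rewrite mem_filter => /andP[_ /allpairsP[[i' a'] [/= _ ag [-> ->]]]] ->.
  by exists i', a'.
have [fr|] := boolP (fresh (i, a)).
  exists (i, a) => //; rewrite mem_filter fr /=.
  by apply/allpairsP; exists (i, a); rewrite mem_enum.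
case/forallPn=> j /=; rewrite negb_imply negbK => /andP[ji /eqP ->].
exists (j, pw i); last by rewrite addmC.
rewrite mem_filter; apply/andP; split; last first.
  by apply/allpairsP; exists (j, pw i); rewrite mem_enum; split=> //; apply: Vg.
apply/forallP => k; apply/implyP => /= kj; apply/eqP => /pw_inj ik.
by move: kj; rewrite -ik ltnNge ltnW.
Qed.

Lemma uniq_pw_sums : uniq pw_sums.
Proof.
rewrite map_inj_in_uniq => [|[i a] [j b]].
  apply: filter_uniq; apply: allpairs_uniq => //; first exact: enum_uniq.
  by move=> [? ?] [? ?] _ _ [-> ->].
rewrite !mem_filter => /andP[/forallP fa /allpairsP[[i' a'] [_ /= ag [? ?]]]].
move=> /andP[/forallP fb /allpairsP[[j' b'] [_ /= bg [? ?]]]] /=; subst i' a' j' b'.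
have [<- /addmI -> //|ij] := eqVneq i j.
move=> /pwD_inj[|||aj bi] //; rewrite ?Hg //.
have [ltij|ltji] := ltnP i j.
  by have /implyP/(_ ltij) := fb i; rewrite bi eqxx.
have ltji' : (j < i)%N by rewrite ltn_neqAle ltji andbT eq_sym.
by have /implyP/(_ ltji') := fa j; rewrite aj eqxx.
Qed.

(** The index [i] occurs with all but [i] elements of [g], and these defects add
    up to ['C(n, 2)]. *)
Lemma size_pw_sums : (size pw_sums + 'C(n, 2) = n * size g)%N.
Proof.
have cnt (i : 'I_n) : (\sum_(a <- g | fresh (i, a)) 1 + i = size g)%N.
  rewrite sum1_count -(count_predC (fun a => fresh (i, a)) g); congr (_ + _)%N.
  pose Vi := [seq pw j | j <- enum 'I_n & (j < i)%N].
  have <- : size Vi = i.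
    rewrite size_map size_filter -sum1_count big_enum_cond /=.
    by rewrite -(big_ord_widen n (fun=> 1%N) (ltnW (ltn_ord i))) sum1_card card_ord.
  rewrite -size_filter; apply/perm_size/uniq_perm.
  - by rewrite map_inj_uniq => [|x y /pw_inj //]; apply: filter_uniq; apply: enum_uniq.
  - exact: filter_uniq.
  move=> a; rewrite mem_filter /=; apply/mapP/andP => [[j]|[/forallPn[j]]].
    rewrite mem_filter => /andP[ji _] ->; split=> //.
    by apply/forallPn; exists j; rewrite /= ji eqxx.
  rewrite /= negb_imply negbK => /andP[ji /eqP ->] _.
  by exists j; rewrite // mem_filter ji mem_enum.
rewrite size_map size_filter -sum1_count big_mkcond big_allpairs /=.
rewrite -bin2_sum big_mkord big_enum /= -big_split /=.
transitivity (\sum_(i < n) size g)%N; last by rewrite sum_nat_const card_ord.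
apply: eq_bigr => i _.
by rewrite -big_mkcond cnt.
Qed.

(** [n * mu - 'C(n, 2)] counts the sums with a pure power, so it is the size of
    [g + g] exactly when there are no other sums. *)
Lemma freiman_absorbing (K : fieldType) :
  freiman (@monomial_ideal_of K n [set` g]) <-> absorbing [set` g].
Proof.
set I := monomial_ideal_of _.
have HG u : [set` g] u -> mdeg u = d by apply: Hg.
have HI : min_num_gens I (size g) by apply: min_num_gens_homog Hg.
pose g2 := undup [seq (u + v)%MM | u <- g, v <- g].
have mem_g2 u : reflect (exists a b, [/\ a \in g, b \in g & u = (a + b)%MM]) (u \in g2).
  rewrite mem_undup; apply: (iffP allpairsP) => [[[a b] [/= ag bg ->]]|[a [b [ag bg ->]]]].
    by exists a, b.
  by exists (a, b).
have HI2 : min_num_gens (ideal_exp I 2) (size g2).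
  have -> : ideal_exp I 2 = @monomial_ideal_of K n [set` g2].
    rewrite mono_sqr; congr monomial_ideal_of; apply/seteqP; split=> u.
      by case=> a ag [b bg <-]; apply/mem_g2; exists a, b.
    by case/mem_g2=> a [b [ag bg ->]]; exists a => //; exists b.
  apply: (min_num_gens_homog _ (D := (d + d)%N)); first exact: undup_uniq.
  by move=> u /mem_g2[a [b [/Hg ad /Hg bd ->]]]; rewrite mdegD ad bd.
have Hspread := analytic_spread_pure_powers K d_gt0 HG Vg.
have sub : {subset pw_sums <= g2}.
  by move=> u /mem_pw_sums[i [c [cg ->]]]; apply/mem_g2; exists (pw i), c.
have Hsz : freiman I <-> size g2 = size pw_sums.
  have szP := size_pw_sums; split=> [[_ [m [m2 [l [Hm Hm2 Hl]]]]]|E].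
    rewrite (min_num_gens_inj Hm HI) (min_num_gens_inj Hm2 HI2).
    by rewrite ((Hspread l).1 Hl); lia.
  split.
    exists d; split; first by exists [set` g].
    by exists [set` g]; split=> //; apply: min_gens_homog HG.
  exists (size g), (size g2), n; split=> //; first exact/Hspread.
  lia.
rewrite Hsz; split=> [E a b ag bg|Habs].
  have [_ eqm] := uniq_min_size uniq_pw_sums sub (eq_leq E).
  have /mem_pw_sums[i [c [cg Eab]]] : (a + b)%MM \in pw_sums.
    by rewrite eqm; apply/mem_g2; exists a, b.
  by exists i, c.
apply/perm_size/uniq_perm; [exact: undup_uniq | exact: uniq_pw_sums|].
move=> u; apply/idP/idP; last exact: sub.
case/mem_g2=> a [b [ag bg ->]]; have [i [c [cg E]]] := Habs a b ag bg.
by apply/mem_pw_sums; exists i, c.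
Qed.

End PurePowers.

(** * Structure of absorbing sets *)

Section Absorbing.
Local Open Scope classical_set_scope.
Local Open Scope ring_scope.
Local Open Scope set_scope.
Local Open Scope nat_scope.
Variables (n d : nat).
Hypotheses (d_gt1 : (1 < d)%N) (n_gt0 : (0 < n)%N).
Variable G : set 'X_{1..n}.
Hypothesis HG : forall u, G u -> mdeg u = d.
Implicit Types (i j k : 'I_n) (u v a b c e : 'X_{1..n}) (S : {set 'I_n}).
Local Notation pw i := (U_(i) *+ d)%MM.

Let d_gt0 : (0 < d)%N := ltnW d_gt1.

Definition mixed u := forall i, u <> pw i.

Definition supp u : {set 'I_n} := [set i | u i != 0%N].

Definition powers_and_face S : set 'X_{1..n} :=
  [set u | mdeg u = d /\ ((exists i, u = pw i) \/ supp u \subset S)]%classic.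

(** If all exponents of a sum were at most [d - 1], its degree [2 * d] would be
    at most [#|S| * (d - 1)]. *)
Lemma powers_and_face_absorbing S : (#|S| * d.-1 < d + d)%N ->
  absorbing d (powers_and_face S).
Proof.
move=> Sd a b [ad [[i ->]|aS]] Hb; first by exists i, b.
case: Hb => bd [[i ->]|bS].
  by exists i, a; split; [split=> //; right | rewrite addmC].
have off c i : supp c \subset S -> i \notin S -> c i = 0%N.
  by move=> /fintype.subsetP/(_ i) cS; apply: contraNeq => ci; apply: cS; rewrite inE.
have [i Hi] : exists i, (d <= (a + b)%MM i)%N.
  apply: contrapT => /forallNP H; move: Sd; rewrite ltnNge => /negP; apply.
  have -> : (d + d = mdeg (a + b))%N by rewrite mdegD ad bd.
  rewrite mdegE (bigID (mem S)) /=.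
  rewrite [X in (_ + X)%N]big1 ?addn0 => [|i iS]; last by rewrite mnmDE !off.
  rewrite -sum_nat_const; apply: leq_sum => i _.
  by rewrite -ltnS prednK // ltnNge; apply/negP/H.
have le_pw : (pw i <= a + b)%MM.
  by apply/mnm_lepP => j; rewrite pwE; case: eqP => [<-|_]; rewrite ?mul1n.
exists i, (a + b - pw i)%MM; rewrite [RHS]addmC submK //; split=> //; split.
  apply/eqP; rewrite -(eqn_add2r (mdeg (pw i))) -mdegD submK // mdegD mdeg_pw.
  by rewrite ad bd.
right; apply/fintype.subsetP => j; rewrite inE mnmBE mnmDE; apply: contraNT => jS.
by rewrite (off a) // (off b) // sub0n.
Qed.

Hypotheses (HV : forall i, G (pw i)) (Habs : absorbing d G).

Lemma mixed_lt u : G u -> mixed u -> forall i, (u i < d)%N.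
Proof.
move=> Gu mu i; rewrite ltnNge; apply/negP => du.
by apply: (mu i); apply: eq_pw => //; apply: HG.
Qed.

Lemma mixedP u : ~ mixed u <-> exists i, u = pw i.
Proof.
split=> [|[i ->]]; last by apply.
by move=> H; apply: contrapT => /forallNP.
Qed.

Lemma mixed_nmod u i : u i <> 0 %[mod d] -> mixed u.
Proof. by move=> ui j E; apply: ui; rewrite E pwE modnMl mod0n. Qed.

(** Modulo [d], the pure powers vanish, so absorption says that the residues
    of [G] form a subgroup of [(Z/d)^n]. *)
Lemma absorbing_add a b : G a -> G b ->
  exists2 e, G e & forall i, e i = a i + b i %[mod d].
Proof.
move=> Ga Gb; have [k [e [Ge E]]] := Habs Ga Gb; exists e => // i.
by rewrite -mnmDE E mnmDE pwE modnMDl.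
Qed.

(** In a group killed by [d], the opposite of a class is its multiple by [d - 1]. *)
Lemma absorbing_sub a b : G a -> G b ->
  exists2 e, G e & forall i, e i + b i = a i %[mod d].
Proof.
move=> Ga Gb.
have mult t : exists2 e, G e & forall i, e i = a i + t * b i %[mod d].
  elim: t => [|t [e Ge He]]; first by exists a => // i; rewrite addn0.
  have [e' Ge' He'] := absorbing_add Ge Gb; exists e' => // i.
  by rewrite He' -modnDml He modnDml mulSn addnCA addnC.
have [e Ge He] := mult d.-1; exists e => // i.
by rewrite -modnDml He modnDml -addnA -mulSnr prednK // addnC mulnC modnMDl.
Qed.

(** The representative of the opposite class complements each nonzero coordinate
    to [d]; as both have degree [d], there are exactly two such coordinates. *)
Lemma card_supp_mixed u : G u -> mixed u -> #|supp u| = 2.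
Proof.
move=> Gu mu; pose i0 := Ordinal n_gt0.
have [e Ge He] := absorbing_sub (HV i0) Gu.
have {}He i : (d %| e i + u i)%N by rewrite /dvdn He pwE modnMl.
have me : mixed e.
  move=> k Ek; have /eqP : mdeg u = 0%N.
    rewrite mdegE big1 // => i _; have := He i.
    rewrite Ek pwE dvdn_addr ?dvdn_mull // /dvdn modn_small ?mixed_lt //.
    by move/eqP.
  by rewrite HG // (gtn_eqF d_gt0).
have E i : (e i + u i = (i \in supp u) * d)%N.
  have ei := mixed_lt Ge me i; have ui := mixed_lt Gu mu i.
  rewrite inE; case/dvdnP: (He i) => t Et; rewrite Et; congr (_ * d)%N.
  case: eqP => [u0|/eqP u0] /=; first by move: Et; rewrite u0 addn0; nia.
  by rewrite -lt0n in u0; nia.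
have : (mdeg e + mdeg u = #|supp u| * d)%N.
  rewrite !mdegE -big_split /= -sum1_card big_distrl /= [RHS]big_mkcond /=.
  by apply: eq_bigr => i _; rewrite E; case: ifP; rewrite ?mul1n.
by rewrite !HG // addnn -mul2n => /eqP; rewrite eqn_pmul2r // => /eqP.
Qed.

Lemma supp_nmod u i : G u -> mixed u -> i \in supp u -> u i <> 0 %[mod d].
Proof.
move=> Gu mu; rewrite inE => ui.
by rewrite modn_small ?mixed_lt // mod0n; apply/eqP.
Qed.

Lemma supp_of_nmod u i j : G u -> i != j -> u i <> 0 %[mod d] ->
  u j <> 0 %[mod d] -> supp u = [set i; j].
Proof.
move=> Gu ij ui uj; apply/esym/eqP; rewrite eqEcard cards2 ij.
rewrite (card_supp_mixed Gu (mixed_nmod ui)) leqnn andbT.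
have nz k : u k <> 0 %[mod d] -> k \in supp u by rewrite inE; apply: contra_notN => /eqP ->.
by apply/fintype.subsetP => k /set2P[] ->; apply: nz.
Qed.

Lemma card2_diff (A B : {set 'I_n}) : #|A| = 2 -> #|B| = 2 -> A != B ->
  exists2 x, x \in A & x \notin B.
Proof.
move=> cA cB AB; apply/fintype.subsetPn; apply: contraNN AB => AB.
by rewrite eqEcard AB cA cB.
Qed.

(** If two supports differ, the sum and the difference of the classes are both
    supported on the symmetric difference; hence the shared coordinate is
    at once opposite and equal, that is, of order two. *)
Lemma two_torsion a b : G a -> mixed a -> G b -> mixed b ->
  supp a != supp b -> forall i, (d %| 2 * a i)%N.
Proof.
move=> Ga ma Gb mb ab.
have ca := card_supp_mixed Ga ma; have cb := card_supp_mixed Gb mb.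
have [j ja jb] := card2_diff ca cb ab.
have [k kb ka] : exists2 k, k \in supp b & k \notin supp a.
  by apply: card2_diff; rewrite // eq_sym.
have jk : j != k by apply: contraNneq ka => <-.
have zero u i : i \notin supp u -> u i = 0%N by rewrite inE negbK => /eqP.
have [e Ge He] := absorbing_add Ga Gb.
have se : supp e = [set j; k].
  apply: supp_of_nmod => //; rewrite He.
    by rewrite (zero b) // addn0; apply: supp_nmod.
  by rewrite (zero a) // add0n; apply: supp_nmod.
have [f Gf Hf] := absorbing_sub Ga Gb.
have sf : supp f = [set j; k].
  apply: supp_of_nmod => // f0.
    apply: (supp_nmod Ga ma ja).
    by rewrite -Hf (zero b j) // addn0.
  apply: (supp_nmod Gb mb kb).
  by have := Hf k; rewrite (zero a k) // -modnDml f0 mod0n.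
have other i : i != j -> (d %| 2 * a i)%N.
  move=> ij; have [ia|/zero ->] := boolP (i \in supp a); last by rewrite muln0.
  have ijk : i \notin [set j; k].
    by rewrite !inE negb_or ij; apply: contraNneq ka => <-.
  have := He i; rewrite zero ?se // => Hi.
  have := Hf i; rewrite zero ?sf // add0n => Hi'.
  by rewrite /dvdn mul2n -addnn -modnDmr -Hi' modnDmr -Hi mod0n.
move=> i; have [->|] := eqVneq i j; last exact: other.
have : (d %| \sum_k 2 * a k)%N by rewrite -big_distrr /= -mdegE HG // dvdn_mull.
rewrite (bigD1 j) //= dvdn_addl //.
by apply: dvdn_sum => k' /other.
Qed.

Hypothesis Hprim : forall q, (2 <= q)%N -> ~ (forall u, G u -> forall i, (q %| u i)%N).

Lemma exists_mixed : exists2 u, G u & mixed u.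
Proof.
apply: contrapT => H; apply: (Hprim d_gt1) => u Gu i.
have [k ->] : exists k, u = pw k by apply/mixedP => mu; apply: H; exists u.
by rewrite pwE dvdn_mull.
Qed.

(** The exponents occurring on the edge form a subgroup of [Z/d].  It is
    generated by a divisor [q] of [d], which divides all exponents of [G], so
    that [q = 1]. *)
Lemma single_edge a : G a -> mixed a ->
  (forall b, G b -> mixed b -> supp b = supp a) ->
  G = powers_and_face (supp a).
Proof.
move=> Ga ma Hsupp; have /eqP/cards2P[i [j [ij sa]]] := card_supp_mixed Ga ma.
pose line t := (U_(i) *+ t + U_(j) *+ (d - t))%MM.
have lineE t k : line t k = ((i == k) * t + (j == k) * (d - t))%N.
  by rewrite mnmDE !mulmnE !mnm1E.
have to_line u : mdeg u = d -> supp u \subset [set i; j] -> u i <= d /\ u = line (u i).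
  move=> ud us; have u0 k : k != i -> k != j -> u k = 0%N.
    move=> ki kj; apply/eqP; have : k \notin supp u.
      by apply: contraNN ki => /(fintype.subsetP us); rewrite !inE (negbTE kj) orbF.
    by rewrite inE negbK.
  have E : (u i + u j = d)%N.
    rewrite -ud mdegE (bigD1 i) //= (bigD1 j) 1?eq_sym //= big1 ?addn0 //.
    by move=> k /andP[ki kj]; apply: u0.
  split; first by rewrite -E leq_addr.
  apply/mnmP => k; rewrite lineE.
  have [<-|ki] := eqVneq i k; first by rewrite eq_sym (negbTE ij) mul1n addn0.
  have [<-|kj] := eqVneq j k; first by rewrite mul0n mul1n add0n -E addKn.
  by rewrite u0 // eq_sym.
pose H t := t <= d /\ G (line t).
have Hd : H d.
  split=> //; have -> // : line d = pw i by rewrite /line subnn mulm0n addm0.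
have Hsub s t : H s -> H t -> t <= s -> H (s - t)%N.
  move=> [sd Gs] [td Gt] ts; split; first by rewrite (leq_trans (leq_subr _ _)).
  have [->|] := posnP (s - t)%N; first by rewrite /line subn0 mulm0n add0m.
  move=> st; have [E|std] := leqP d (s - t)%N.
    by have -> : (s - t = d)%N by [lia]; case: Hd.
  have [e Ge He] := absorbing_sub Gs Gt.
  have ei : e i = s - t %[mod d].
    apply/eqP; rewrite -(eqn_modDr t); have := He i.
    by rewrite !lineE eqxx eq_sym (negbTE ij) !mul1n !addn0 subnK // => ->.
  have me : mixed e by apply: (mixed_nmod (i := i)); rewrite ei modn_small // mod0n; lia.
  have {}ei : e i = (s - t)%N.
    by move: ei; rewrite !modn_small // mixed_lt.
  have es : supp e \subset [set i; j] by rewrite Hsupp // sa.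
  have [_] := to_line e (HG Ge) es.
  by rewrite ei => <-.
have exH : exists t, (0 < t)%N && `[< H t >] by exists d; rewrite d_gt0; apply/asboolP.
case: (ex_minnP exH) => q /andP[q_gt0 /asboolP Hq] qmin.
have qH t : H t -> (q %| t)%N.
  elim/ltn_ind: t => t IH Ht; have [->|t_gt0] := posnP t; first exact: dvdn0.
  have qt : q <= t by apply: qmin; rewrite t_gt0; apply/asboolP.
  rewrite -(subnK qt) dvdn_addl //; apply: (IH (t - q)); first by rewrite ltn_subrL q_gt0.
  exact: Hsub.
have q1 : q = 1%N.
  apply/eqP; rewrite eqn_leq q_gt0 andbT leqNgt; apply/negP => q2.
  apply: (Hprim q2) => u Gu k; have qd := qH _ Hd.
  have [mu|/mixedP[l ->]] := pselect (mixed u); last by rewrite pwE dvdn_mull.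
  have us : supp u \subset [set i; j] by rewrite Hsupp // sa.
  have [ud Eu] := to_line u (HG Gu) us.
  have qu : (q %| u i)%N by apply: qH; split=> //; rewrite -Eu.
  by rewrite Eu lineE dvdn_add // dvdn_mull // dvdn_sub.
have Hall t : t <= d -> H t.
  rewrite q1 in Hq => td; rewrite -(subKn td); elim: (d - t)%N (leq_subr t d) => [|s IH] sd.
    by rewrite subn0.
  by rewrite subnS -subn1; apply: Hsub => //; [apply/IH/ltnW | lia].
apply/seteqP; split=> [u Gu|u [ud [[k ->]//|us]]].
  split; first exact: HG.
  have [mu|/mixedP] := pselect (mixed u); last by left.
  by right; rewrite Hsupp.
rewrite sa in us; have [ui ->] := to_line u ud us.
by case: (Hall _ ui).
Qed.

(** All exponents are multiples of [d / gcd(d, 2)], which is at least [2] as soon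
    as [d] is at least [3]. *)
Lemma degree_two a b : G a -> mixed a -> G b -> mixed b -> supp a != supp b -> d = 2.
Proof.
move=> Ga ma Gb mb ab.
have tors c k : G c -> d %| 2 * c k.
  move=> Gc; have [mc|/mixedP[l ->]] := pselect (mixed c); last first.
    by rewrite pwE mulnA dvdn_mull.
  have [ca|ca] := eqVneq (supp c) (supp a); last exact: (two_torsion Gc mc Ga).
  by apply: (two_torsion Gc mc Gb mb); rewrite ca.
apply/eqP; rewrite eqn_leq d_gt1 andbT leqNgt; apply/negP => d3.
have [od|ed] := boolP (odd d).
  apply: (Hprim d_gt1) => c Gc k; have := tors c k Gc.
  by rewrite Gauss_dvdr // coprimen2.
have dE : d = 2 * d./2 by rewrite mul2n even_halfK.
apply: (@Hprim d./2) => [|c Gc k]; first by lia.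
by have := tors c k Gc; rewrite {1}dE dvdn_pmul2l.
Qed.

Section DegreeTwo.
Hypothesis d2 : d = 2.

Lemma pw2 i : pw i = (U_(i) + U_(i))%MM.
Proof. by apply/mnmP => j; rewrite pwE mnmDE mnm1E d2 muln2 addnn. Qed.

Lemma edge_at u i : mdeg u = d -> mixed u -> i \in supp u ->
  exists2 j, i != j & u = (U_(i) + U_(j))%MM.
Proof.
move=> ud mu; rewrite inE -lep1mP => iu.
have : mdeg (u - U_(i))%MM == 1.
  by rewrite -(eqn_add2r (mdeg U_(i)%MM)) -mdegD submK // ud d2 mdeg1.
case/mdeg1P=> j /eqP E; have {}E : u = (U_(i) + U_(j))%MM by rewrite -(submK iu) E addmC.
exists j => //; apply: contra_notN (mu i) => /eqP ij.
by rewrite E -ij pw2.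
Qed.

Lemma absorbing_square_free u v : G u -> G v -> exists i, 2 <= (u + v)%MM i.
Proof.
move=> Gu Gv; have [i [c [_ E]]] := Habs Gu Gv; exists i.
by rewrite E mnmDE pwE eqxx d2 leq_addr.
Qed.

(** The sum of two disjoint edges is square-free, so it cannot contain any of the
    pure powers, which are squares here. *)
Lemma edges_meet i j k l : G (U_(i) + U_(j))%MM -> G (U_(k) + U_(l))%MM ->
  i != j -> k != l -> i != k -> i != l -> j != k -> j != l -> False.
Proof.
move=> Gij Gkl ij kl ik il jk jl.
have [x] := absorbing_square_free Gij Gkl.
rewrite !mnmDE !mnm1E.
have [<-|_] := eqVneq i x.
  by rewrite !(eq_sym _ i) (negbTE ij) (negbTE ik) (negbTE il).
have [<-|_] := eqVneq j x.
  by rewrite !(eq_sym _ j) (negbTE jk) (negbTE jl).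
have [<-|_] := eqVneq k x; last by case: (l == x).
by rewrite (eq_sym l) (negbTE kl).
Qed.

(** In the sum of two edges through [i], only the square of the variable [i] can
    be split off, which leaves the third side. *)
Lemma triangle i j k : i != j -> i != k -> j != k ->
  G (U_(i) + U_(j))%MM -> G (U_(i) + U_(k))%MM -> G (U_(j) + U_(k))%MM.
Proof.
move=> ij ik jk Gij Gik; have [x [c [Gc E]]] := Habs Gij Gik.
have {}E : (U_(i) + U_(i) + (U_(j) + U_(k)) = U_(x) + U_(x) + c)%MM.
  by rewrite -(pw2 x) -E; apply/mnmP => y; rewrite !mnmDE; lia.
have [ix|ix] := eqVneq i x; first by move: E; rewrite ix => /addmI ->.
have := congr1 (fun m : 'X_{1..n} => m x) E.
rewrite !mnmDE !mnm1E eqxx (negbTE ix).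
have : (j == x) + (k == x) <= 1.
  by case: (eqVneq j x) => [<-|_]; [rewrite eq_sym (negbTE jk) | case: (k == x)].
by move=> H1 H2; move: H1; rewrite -[X in X <= 1]/(0 + 0 + _) H2.
Qed.

(** Two edges through a common vertex generate a triangle, and an edge leaving it
    would miss one of its sides. *)
Lemma triangle_face a b : G a -> mixed a -> G b -> mixed b -> supp a != supp b ->
  exists2 S : {set 'I_n}, #|S| = 3 & G = powers_and_face S.
Proof.
move=> Ga ma Gb mb ab.
have ca := card_supp_mixed Ga ma; have cb := card_supp_mixed Gb mb.
have [j ja jb] := card2_diff ca cb ab.
have [k kb ka] : exists2 k, k \in supp b & k \notin supp a.
  by apply: card2_diff; rewrite // eq_sym.
have jk : j != k by apply: contraNneq ka => <-.
have [i ji Ea] := edge_at (HG Ga) ma ja.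
have [i' ki' Eb] := edge_at (HG Gb) mb kb.
have ki : k != i.
  by apply: contraNneq ka => ->; rewrite Ea inE mnmDE !mnm1E eqxx addn1.
have ji' : j != i'.
  by apply: contraNneq jb => ->; rewrite Eb inE mnmDE !mnm1E eqxx addn1.
have ii' : i = i'.
  apply/eqP; apply: contraT => ii'; exfalso.
  by apply: (@edges_meet j i k i'); rewrite -?Ea -?Eb // eq_sym.
subst i'; have Gij : G (U_(i) + U_(j))%MM by rewrite addmC -Ea.
have Gik : G (U_(i) + U_(k))%MM by rewrite addmC -Eb.
rewrite eq_sym in ji; rewrite eq_sym in ki.
have Gjk := triangle ji ki jk Gij Gik.
pose S := i |: [set j; k].
have edges x y : x \in S -> y \in S -> x != y -> G (U_(x) + U_(y))%MM.
  by rewrite !inE => /or3P[] /eqP-> /or3P[] /eqP->; rewrite ?eqxx // => _; rewrite 1?addmC.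
exists S; first by rewrite cardsU1 cards2 !inE negb_or ji ki jk.
apply/seteqP; split=> [u Gu|u [ud Hu]].
  split; first exact: HG.
  have [mu|/mixedP] := pselect (mixed u); last by left.
  right; apply/fintype.subsetP => x xu; apply: contraT => xS; exfalso.
  have [y xy Eu] := edge_at (HG Gu) mu xu.
  (* The side of the triangle avoiding y is disjoint from the edge u. *)
  have [p [q [pS qS pq py qy]]] : exists p q, [/\ p \in S, q \in S, p != q, p != y & q != y].
    have [iS jS kS] : [/\ i \in S, j \in S & k \in S] by rewrite !inE !eqxx !orbT.
    have [yi|yi] := eqVneq i y; first by exists j, k; rewrite -yi !(eq_sym _ i).
    have [yj|yj] := eqVneq j y; first by exists i, k; rewrite -yj (eq_sym k).
    by exists i, j.
  rewrite Eu in Gu; apply: (edges_meet Gu (edges _ _ pS qS pq)) => //; rewrite 1?eq_sym //.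
  - by apply: contraNneq xS => <-.
  - by apply: contraNneq xS => <-.
have [mu|/mixedP[x ->]//] := pselect (mixed u).
case: Hu => [[x ux]|/fintype.subsetP uS]; first by case: (mu x).
have [x xu] : exists x, x \in supp u.
  apply/set0Pn; apply: contraTneq d_gt0 => u0; rewrite -ud mdegE big1 // => x _.
  by have := finset.in_set0 x; rewrite -u0 inE => /negbFE/eqP.
have [y xy Eu] := edge_at ud mu xu.
rewrite Eu; apply: edges => //; apply: uS => //.
by rewrite Eu inE mnmDE !mnm1E eqxx addn1.
Qed.

End DegreeTwo.

Lemma absorbing_structure : exists S,
  G = powers_and_face S /\ (#|S| = 2 \/ #|S| = 3 /\ d = 2).
Proof.
have [a Ga ma] := exists_mixed.
have [Hall|/existsNP[b /not_implyP[Gb /not_implyP[mb /eqP ba]]]] :=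
    pselect (forall b, G b -> mixed b -> supp b = supp a).
  by exists (supp a); split; [exact: single_edge | left; exact: card_supp_mixed].
have d2 := degree_two Gb mb Ga ma ba.
by have [S S3 ES] := triangle_face d2 Gb mb Ga ma ba; exists S; split=> //; right.
Qed.

End Absorbing.

(** * The model ideals *)

Section Model.
Local Open Scope classical_set_scope.
Local Open Scope ring_scope.
Variables (K : fieldType) (n d : nat).
Local Notation mono := (@monomial_ideal_of K n).

(** A monomial supported on [S] is a product of variables in [S]. *)
Lemma sumset_exp_units (S : {set 'I_n}) k :
  sumset_exp [set U_(i)%MM | i in [set` S]] k =
  [set u : 'X_{1..n} | mdeg u = k /\ supp u \subset S].
Proof.
have suppU (i : 'I_n) u : supp (U_(i) + u)%MM = i |: supp u.
  by apply/setP => j; rewrite !inE mnmDE mnm1E addn_eq0 negb_and eqb0 negbK eq_sym.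
elim: k => [|k IH] /=.
  apply/seteqP; split=> [_ ->|u [/eqP]]; last by rewrite mdeg_eq0 => /eqP.
  by split; [rewrite mdeg0 | apply/fintype.subsetP => i; rewrite inE mnm0E].
rewrite IH; apply/seteqP; split=> [_ [_ [i iS <-] [v [vk vS] <-]]|u [uk uS]].
  split; first by rewrite mdegD mdeg1 vk.
  by rewrite suppU finset.subUset finset.sub1set iS.
have [i ui] : exists i, u i != 0%N.
  apply/existsP; apply: contraT; rewrite negb_exists => /forallP u0.
  move: uk; rewrite mdegE big1 // => i _; exact/eqP/negPn/u0.
have iu : (U_(i) <= u)%MM by rewrite lep1mP.
have Eu : u = (U_(i) + (u - U_(i)))%MM by rewrite addmC submK.
move: uS; rewrite {1}Eu suppU finset.subUset finset.sub1set => /andP[iS uS].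
exists U_(i)%MM; first by exists i.
exists (u - U_(i))%MM => //; split=> //.
by move: uk; rewrite {1}Eu mdegD mdeg1 => -[].
Qed.

Lemma freiman_modelE (r : nat) (s : 'S_n) :
  @freiman_model K n d r s =
  mono (powers_and_face d [set s i | i : 'I_n & (i < r)%N]%SET).
Proof.
set S := (X in powers_and_face d X).
have memS i : (s i \in S) = (i < r)%N.
  by rewrite mem_imset ?inE //; apply: perm_inj.
have -> : @freiman_model K n d r s =
    ideal_add (ideal_exp (mono [set U_(i)%MM | i in [set` S]]) d)
              (mono [set (U_(s i) *+ d)%MM | i in [set i : 'I_n | (r <= i)%N]]).
  congr (ideal_add (ideal_exp _ d) _); congr ideal_gen; apply/seteqP; split.
  - by move=> _ [i /= ir <-]; exists U_(s i)%MM => //; exists (s i); rewrite //= memS.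
  - by move=> _ [_ [_ /imsetP[i ir ->] <-] <-]; exists i => //; rewrite inE in ir.
  - by move=> _ [i /= ir <-]; exists (U_(s i) *+ d)%MM; [exists i | rewrite mpolyXn].
  - by move=> _ [_ [i ir <-] <-]; exists i; rewrite // mpolyXn.
rewrite mono_exp sumset_exp_units mono_add; congr monomial_ideal_of.
apply/seteqP; split=> [u [[ud uS]|[i ir <-]]|u [ud [[i Eu]|uS]]].
- by split=> //; right.
- by split; [rewrite mdeg_pw | left; exists (s i)].
- have [ir|ir] := ltnP (s^-1%g i) r; last by right; exists (s^-1%g i); rewrite ?permKV.
  left; split=> //; apply/fintype.subsetP => j; rewrite Eu inE pwE.
  by case: (eqVneq i j) => [<- _|//]; rewrite -[i](permKV s) memS.
- by left.
Qed.

Lemma card_initial r : (r <= n)%N -> #|[set i : 'I_n | (i < r)%N]%SET| = r.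
Proof.
move=> rn; rewrite -sum1_card; under eq_bigl do rewrite inE.
by rewrite -(big_ord_widen n (fun=> 1%N) rn) sum1_card card_ord.
Qed.

(** The permutation listing [S] before its complement. *)
Lemma exists_perm_initial (S : {set 'I_n}) :
  exists s : 'S_n, [set s i | i : 'I_n & (i < #|S|)%N]%SET = S.
Proof.
pose t := enum S ++ enum (~: S)%SET.
have st : size t = n by rewrite size_cat -!cardE cardsC card_ord.
have ut : uniq t.
  rewrite cat_uniq !enum_uniq andbT /=; apply/hasPn => i; rewrite !mem_enum.
  by rewrite !inE.
pose f (i : 'I_n) := nth i t i.
have fE i0 i : f i = nth i0 t i by apply: set_nth_default; rewrite st.
have inj_f : injective f.
  move=> i j; rewrite (fE i j) /f => /eqP; rewrite nth_uniq ?st // => /eqP.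
  exact: val_inj.
exists (perm inj_f); apply/eqP; rewrite eqEcard card_imset; last exact: perm_inj.
have cS : (#|S| <= n)%N by rewrite -[X in (_ <= X)%N]card_ord max_card.
have fS (i : 'I_n) : (i < #|S|)%N -> f i \in S.
  by move=> iS; rewrite /f nth_cat -cardE iS -mem_enum mem_nth // -cardE.
apply/andP; split.
  by apply/fintype.subsetP => x /imsetP[i]; rewrite inE => iS ->; rewrite permE fS.
by rewrite card_initial.
Qed.

(** Dividing all exponents by [q] exhibits the ideal as a [q]-th
    pseudo-Frobenius power. *)
Lemma primitive_gens (G : set 'X_{1..n}) : (0 < d)%N ->
  (forall u, G u -> mdeg u = d) -> ~ proper_pseudo_frobenius_power (mono G) ->
  forall q, (2 <= q)%N -> ~ (forall u, G u -> forall i, (q %| u i)%N).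
Proof.
move=> d_gt0 HG Hpf q q2 Hq; apply: Hpf.
pose quo (u : 'X_{1..n}) : 'X_{1..n} := [multinom u i %/ q | i < n]%N.
have quoK u : G u -> (quo u *+ q)%MM = u.
  by move=> Gu; apply/mnmP => i; rewrite mulmnE mnmE divnK // Hq.
pose H := [set quo u | u in G].
have HH v : H v -> mdeg v = (d %/ q)%N.
  case=> u Gu <-; rewrite -(HG u Gu) -{2}(quoK u Gu) mdegMn mulnK //.
  exact: ltnW.
exists q, (mono H); split=> //; first by exists H.
exists H; split; first exact: min_gens_homog HH.
have -> : [set (u *+ q)%MM | u in H] = G.
  apply/seteqP; split=> [_ [_ [u Gu <-] <-]|u Gu]; first by rewrite quoK.
  by exists (quo u); [exists u | rewrite quoK].
exact: min_gens_homog HG.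
Qed.

End Model.

Theorem theorem2p4 (K : fieldType) (n d : nat) (I : set {mpoly K[n]})
    (hn : (2 <= n)%N) (hd : (2 <= d)%N)
    (hI : equigenerated_monomial I d)
    (hht : ideal_height I n)
    (hpf : ~ proper_pseudo_frobenius_power I) :
  freiman I <->
  exists (s : 'S_n) (r : nat),
    [/\ (0 < r)%N,
        (d = 2 -> (r <= minn 3 n)%N),
        ((3 <= d)%N -> (r <= minn 2 n)%N)
      & I = freiman_model d r s].
Proof.
case: hI => _ [G [[EI _] HG]]; subst I.
have d_gt0 : (0 < d)%N := ltnW hd; have n_gt0 : (0 < n)%N := ltnW hn.
have HV := pure_power_in HG hht.
have [g ug Eg] := homog_gens_finite HG.
have Hfr : freiman (@monomial_ideal_of K n G) <-> absorbing d G.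
  by rewrite Eg in HG HV *; apply: freiman_absorbing.
rewrite Hfr; split=> [Habs|[s [r [r_gt0 r2 r3 EG]]]].
  have [S [-> HS]] := absorbing_structure hd n_gt0 HG HV Habs (primitive_gens d_gt0 HG hpf).
  have Sn : (#|S| <= n)%N by rewrite -[X in (_ <= X)%N]card_ord max_card.
  have [s Es] := exists_perm_initial S; exists s, #|S|; split.
  - by case: HS => [|[]] ->.
  - by move=> _; rewrite leq_min Sn andbT; case: HS => [|[]] ->.
  - move=> d3; rewrite leq_min Sn andbT; case: HS => [->//|[_ d2]].
    by rewrite d2 in d3.
  - by rewrite freiman_modelE Es.
rewrite freiman_modelE in EG; set S := (X in powers_and_face d X) in EG.
have -> : G = powers_and_face d S by apply: (mono_homog_inj HG _ EG) => u [].
apply: powers_and_face_absorbing => //.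
have Sr : (#|S| <= r)%N.
  rewrite card_imset; last exact: perm_inj.
  have [rn|nr] := leqP r n; last first.
    by rewrite (leq_trans (max_card _)) // card_ord ltnW.
  by rewrite card_initial.
apply: leq_ltn_trans (_ : (r * d.-1 < _)%N); first by rewrite leq_mul2r Sr orbT.
have [d2|d3] : d = 2%N \/ (3 <= d)%N by lia.
  by have := r2 d2; rewrite leq_min d2 => /andP[r3' _]; nia.
by have := r3 d3; rewrite leq_min => /andP[r2' _]; nia.
Qed.
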